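(* Let $\mathcal{U}$ be a non-principal ultrafilter on $\mathbb{N}$. If $A$ is a C*-algebra with infinitely many extremal tracial states, then there are $2^{2^{\aleph_0}}$ (that is, there is a family of $2^{2^{\aleph_0}}$ pairwise distinct) traces on the ultrapower $A^{\mathcal{U}}$ that are not $\mathcal{U}$-limits of traces on $A$.
   Context: For a C*-algebra $A$, $l^\infty(A)$ is the C*-algebra of norm-bounded sequences in $A$ with pointwise operations, $c_{\mathcal{U}}(A)=\{(a_n)\in l^\infty(A):\lim_{n\to\mathcal{U}}\|a_n\|=0\}$ is a closed two-sided ideal in it, and $A^{\mathcal{U}}=l^\infty(A)/c_{\mathcal{U}}(A)$. The class of $(a_n)$ is written $(a_n)^{\mathcal{U}}$. A trace on a C*-algebra is a bounded positive linear functional $\tau$ with $\tau(ab)=\tau(ba)$ for all $a,b$; a tracial state is a trace of norm $1$; a tracial state is extremal if it is an extreme point of the convex set of tracial states. The $\mathcal{U}$-limit of a norm-bounded sequence $(\tau_n)$ of traces on $A$ is the trace on $A^{\mathcal{U}}$ given by $(a_n)^{\mathcal{U}}\mapsto\lim_{n\to\mathcal{U}}\tau_n(a_n)$. *)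

(* Defs.v *)
From HB Require Import structures.
From mathcomp Require Import all_boot all_order all_algebra complex.
From mathcomp Require Import ring lra.
From mathcomp Require Import boolp classical_sets functions cardinality filter.
From mathcomp Require Import reals topology normedtype.

Set Implicit Arguments.
Unset Strict Implicit.
Unset Printing Implicit Defensive.

Import Order.TTheory GRing.Theory Num.Theory.
Import numFieldNormedType.Exports.

Local Open Scope classical_set_scope.
Local Open Scope ring_scope.
Local Open Scope complex_scope.
Local Open Scope quotient_scope.

(* Not necessarily unital. The norm of a normedModType over R[i] is itself     *)
(* R[i]-valued, with values in the nonnegative reals.                          *)
HB.mixin Record CompleteNormedModule_isCStarAlgebra (R : realType) (A : Type)
    of CompleteNormedModule R[i] A := {
  cmul : A -> A -> A;
  cstar : A -> A;
  cmulA : associative cmul;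
  cmulDl : left_distributive cmul +%R;
  cmulDr : right_distributive cmul +%R;
  cscaleAl : forall (z : R[i]) (a b : A), z *: cmul a b = cmul (z *: a) b;
  cscaleAr : forall (z : R[i]) (a b : A), z *: cmul a b = cmul a (z *: b);
  cnormM : forall a b : A, `|cmul a b| <= `|a| * `|b|;
  cstarK : involutive cstar;
  cstarD : {morph cstar : a b / a + b};
  cstarZ : forall (z : R[i]) (a : A), cstar (z *: a) = z^* *: cstar a;
  cstarM : forall a b : A, cstar (cmul a b) = cmul (cstar b) (cstar a);
  cnorm_starM : forall a : A, `|cmul (cstar a) a| = `|a| ^+ 2
}.

#[short(type="cstarAlgType")]
HB.structure Definition CStarAlgebra (R : realType) :=
  {A of CompleteNormedModule_isCStarAlgebra R A & CompleteNormedModule R[i] A}.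

Lemma Re_norm_ge0 (R : realType) (c : R[i]) : 0 <= complex.Re `|c|.
Proof. by rewrite -ler0c RRe_real ?normr_real ?normr_ge0. Qed.

Section RealNorm.
Variables (R : realType) (V : normedModType R[i]).
Implicit Types x y z : V.

Definition rnorm x : R := complex.Re `|x|.

Lemma rnormE x : `|x| = (rnorm x)%:C.
Proof. by rewrite /rnorm RRe_real ?normr_real. Qed.

Lemma rnorm_ge0 x : 0 <= rnorm x.
Proof. by rewrite -lecR -rnormE normr_ge0. Qed.

Lemma rnorm0 : rnorm (0 : V) = 0.
Proof. by rewrite /rnorm normr0. Qed.

Lemma rnorm_eq0 x : rnorm x = 0 -> x = 0.
Proof. by move=> x0; apply/normr0_eq0; rewrite rnormE x0. Qed.

Lemma rnormD x y : rnorm (x + y) <= rnorm x + rnorm y.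
Proof. by rewrite -lecR rmorphD/= -!rnormE ler_normD. Qed.

Lemma rnormN x : rnorm (- x) = rnorm x.
Proof. by rewrite /rnorm normrN. Qed.

Lemma rdistC x y : rnorm (x - y) = rnorm (y - x).
Proof. by rewrite -rnormN opprB. Qed.

Lemma rdistD z x y : rnorm (x - y) <= rnorm (x - z) + rnorm (z - y).
Proof. by rewrite -[x - y](subrKA z) rnormD. Qed.

Lemma rnormZ (c : R[i]) x : rnorm (c *: x) = complex.Re `|c| * rnorm x.
Proof.
by apply/complexI; rewrite rmorphM/= -!rnormE normrZ.
Qed.

Lemma rball x (e : R) y : ball x (e%:C) y <-> rnorm (x - y) < e.
Proof. by rewrite -ball_normE /ball_/= rnormE ltcR. Qed.

Lemma rcvg (F : set_system V) (FF : Filter F) x :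
  (forall e : R, 0 < e -> F [set y | rnorm (x - y) < e]) -> F --> x.
Proof.
move=> H; apply/cvg_ballP => e e0.
have er : (complex.Re e)%:C = e by rewrite RRe_real// gtr0_real.
rewrite -er; have {}e0 : 0 < complex.Re e by rewrite -ltcR er.
by apply: filterS (H _ e0) => y /= /rball.
Qed.

End RealNorm.

Section Completeness.
Variables (R : realType).

Let half_pow (C e : R) : 0 <= C -> 0 < e -> exists k, C * (2^-1) ^+ k < e.
Proof.
move=> C0 e0.
have [k Ck] : exists k, C / e < k%:R.
  by exists (Num.bound (C / e)); apply: archi_boundP; rewrite divr_ge0// ltW.
exists k; rewrite exprVn ltr_pdivrMr ?exprn_gt0// mulrC -ltr_pdivrMr//.
by apply: lt_trans Ck _; rewrite -natrX ltr_nat ltn_expl.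
Qed.

Lemma fast_cauchy_cvg (V : completeNormedModType R[i]) (u : nat -> V) :
  (forall k, rnorm (u k.+1 - u k) <= (2^-1) ^+ k) ->
  exists l, forall k, rnorm (u k - l) <= 2 * (2^-1) ^+ k.
Proof.
move=> H.
have D k m : rnorm (u (k + m)%N - u k) <= 2 * (2^-1) ^+ k - 2 * (2^-1) ^+ (k + m).
  elim: m => [|m IH]; first by rewrite addn0 !subrr rnorm0.
  apply: le_trans (rdistD (u (k + m)%N) _ _) _.
  rewrite addnS; have := H (k + m)%N; rewrite exprS; lra.
have Dk k m : (k <= m)%N -> rnorm (u m - u k) <= 2 * (2^-1) ^+ k.
  move=> /subnKC <-; apply: le_trans (D _ _) _.
  by rewrite lerBlDr lerDl mulr_ge0// exprn_ge0// invr_ge0.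
have : cvg (u @ \oo).
  apply: cauchy_cvg; apply/cauchy_exP => e e0.
  have er : (complex.Re e)%:C = e by rewrite RRe_real// gtr0_real.
  rewrite -er; have {}e0 : 0 < complex.Re e by rewrite -ltcR er.
  have [k ke] := @half_pow 2 _ (ler0n _ 2) e0.
  exists (u k); exists k => // m /= km; apply/rball.
  by rewrite rdistC; apply: le_lt_trans ke; exact: Dk.
move=> /cvg_ex[l ul]; exists l => k; apply/ler_addgt0Pr => e e0.
have eC : 0 < e%:C :> R[i] by rewrite ltcR.
have [m _ Hm] := (cvg_ballP _ _).1 ul _ eC.
have /rball lm := Hm (maxn k m) (leq_maxr _ _).
apply: le_trans (rdistD (u (maxn k m)) _ _) _; apply: lerD.
  by rewrite rdistC Dk// leq_maxl.
by rewrite rdistC ltW.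
Qed.

Lemma fast_cauchy_complete (V : normedModType R[i]) :
  (forall u : nat -> V, (forall k, rnorm (u k.+1 - u k) <= (2^-1) ^+ k) ->
    exists C l, forall k, rnorm (u k - l) <= C * (2^-1) ^+ k) ->
  forall F : set_system V, ProperFilter F -> cauchy F -> cvg F.
Proof.
move=> FC F FF /cauchyP Fc.
have p0 k : 0 < (2^-1) ^+ k :> R by rewrite exprn_gt0 ?invr_gt0 ?ltr0n.
have Q k : {x : V | F [set y | rnorm (x - y) < (2^-1) ^+ k.+2]}.
  apply: cid; have eC : 0 < ((2^-1) ^+ k.+2)%:C :> R[i] by rewrite ltcR.
  have [x Fx] := Fc _ eC; exists x.
  by apply: filterS Fx => y /rball.
pose x k := sval (Q k); have Fx k : F _ := svalP (Q k).
have [k|C [l xl]] := FC x.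
  have [y /= [y1 y2]] := filter_ex (filterI (Fx k.+1) (Fx k)).
  apply: le_trans (rdistD y _ _) _; move: y1 y2; rewrite -/(x k) -/(x k.+1) [rnorm (y - _)]rdistC.
  have := p0 k; rewrite !exprS; lra.
have C0 : 0 <= C.
  by have := xl 0%N; rewrite expr0 mulr1; apply: le_trans; exact: rnorm_ge0.
apply/cvg_ex; exists l; apply: rcvg => e e0.
have [k ke] := @half_pow (C + 1) e (addr_ge0 C0 ler01) e0.
apply: filterS (Fx k) => y /= xy.
apply: le_lt_trans (rdistD (x k) _ _) _; apply: le_lt_trans ke.
rewrite rdistC mulrDl mul1r; apply: lerD (xl k) _.
apply: le_trans (ltW xy) _; have := p0 k; rewrite !exprS; lra.
Qed.

End Completeness.

Section CStarTheory.
Variables (R : realType) (A : cstarAlgType R).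
Implicit Types a b : A.

Lemma cmulNl a b : cmul (- a) b = - cmul a b.
Proof. by rewrite -scaleN1r -cscaleAl scaleN1r. Qed.

Lemma cmulNr a b : cmul a (- b) = - cmul a b.
Proof. by rewrite -scaleN1r -cscaleAr scaleN1r. Qed.

Lemma cmulBl a b c : cmul (a - b) c = cmul a c - cmul b c.
Proof. by rewrite cmulDl cmulNl. Qed.

Lemma cmulBr a b c : cmul c (a - b) = cmul c a - cmul c b.
Proof. by rewrite cmulDr cmulNr. Qed.

Lemma cstarN a : cstar (- a) = - cstar a.
Proof. by rewrite -scaleN1r cstarZ rmorphN1 scaleN1r. Qed.

Lemma cstarB a b : cstar (a - b) = cstar a - cstar b.
Proof. by rewrite cstarD cstarN. Qed.

Lemma rnormM a b : rnorm (cmul a b) <= rnorm a * rnorm b.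
Proof. by rewrite -lecR rmorphM/= -!rnormE cnormM. Qed.

Lemma rnorm_starM a : rnorm (cmul (cstar a) a) = rnorm a ^+ 2.
Proof. by apply/complexI; rewrite rmorphXn/= -!rnormE cnorm_starM. Qed.

Lemma rnorm_star a : rnorm (cstar a) = rnorm a.
Proof.
suff H b : rnorm b <= rnorm (cstar b).
  by apply/le_anti; rewrite H andbT -[X in _ <= rnorm X]cstarK H.
have [->|b0] := eqVneq (rnorm b) 0; first exact: rnorm_ge0.
have {}b0 : 0 < rnorm b by rewrite lt_def b0 rnorm_ge0.
by rewrite -(ler_pM2r b0) -expr2 -rnorm_starM rnormM.
Qed.

End CStarTheory.

Section Linfty.
Variables (R : realType) (A : cstarAlgType R).

Definition bounded_seq : {pred nat -> A} :=
  [pred a | `[< exists M : R, forall n, rnorm (a n) <= M >]].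

Record linfty := Linfty { linfty_val :> nat -> A; _ : linfty_val \in bounded_seq }.

HB.instance Definition _ := [isSub for linfty_val].
HB.instance Definition _ := [Choice of linfty by <:].

Fact bounded_seq_submod : submod_closed bounded_seq.
Proof.
split=> [|c a b /asboolP[M aM] /asboolP[N bN]]; apply/asboolP.
  by exists 0 => n; rewrite rnorm0.
exists (complex.Re `|c| * M + N) => n; apply: le_trans (rnormD _ _) _.
by rewrite rnormZ lerD// ler_wpM2l// Re_norm_ge0.
Qed.

HB.instance Definition _ :=
  GRing.isSubmodClosed.Build R[i] (nat -> A) bounded_seq bounded_seq_submod.
HB.instance Definition _ := [SubChoice_isSubLmodule of linfty by <:].

Implicit Types a b : linfty.

Lemma linftyP a b : (forall n, a n = b n) -> a = b.
Proof. by move=> ab; apply/val_inj/funext. Qed.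

Lemma linfty_bounded a : exists M : R, forall n, rnorm (a n) <= M.
Proof. by case: a => a /= /asboolP. Qed.

Definition linfty_norm a : R := sup (range (fun n => rnorm (a n))).

Lemma linfty_normP a (M : R) :
  linfty_norm a <= M <-> forall n, rnorm (a n) <= M.
Proof.
split=> [aM n|aM]; last first.
  by apply: ge_sup => [|_ [n _ <-]//]; exists (rnorm (a 0%N)); exists 0%N.
apply: le_trans aM; apply: ub_le_sup; last by exists n.
by have [M' aM'] := linfty_bounded a; exists M' => _ [m _ <-].
Qed.

Lemma linfty_norm_ge a n : rnorm (a n) <= linfty_norm a.
Proof. exact: ((linfty_normP a _).1 (lexx _)). Qed.

Lemma linfty_norm_ge0 a : 0 <= linfty_norm a.
Proof. exact: le_trans (rnorm_ge0 _) (linfty_norm_ge a 0%N). Qed.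

Lemma linfty_normD a b :
  (linfty_norm (a + b))%:C <= (linfty_norm a)%:C + (linfty_norm b)%:C :> R[i].
Proof.
rewrite -rmorphD/= lecR; apply/linfty_normP => n /=.
by apply: le_trans (rnormD _ _) _; rewrite lerD ?linfty_norm_ge.
Qed.

Lemma linfty_normZ (c : R[i]) a :
  (linfty_norm (c *: a))%:C = `|c| * (linfty_norm a)%:C :> R[i].
Proof.
have H d b : linfty_norm (d *: b) <= complex.Re `|d| * linfty_norm b.
  apply/linfty_normP => n /=.
  by rewrite rnormZ ler_wpM2l ?Re_norm_ge0 ?linfty_norm_ge.
rewrite -[`|c|]RRe_real ?normr_real// -(rmorphM (real_complex R)); congr (_%:C).
apply/le_anti; rewrite H andTb.
have [->|cn0] := eqVneq c 0; first by rewrite normr0 mul0r linfty_norm_ge0.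
have cp : 0 < complex.Re `|c|.
  by rewrite -ltcR RRe_real ?normr_real// normr_gt0.
rewrite -ler_pdivlMl//; apply: le_trans (_ : linfty_norm (c^-1 *: (c *: a)) <= _).
  by rewrite scalerA mulVf// scale1r.
apply: le_trans (H _ _) _; rewrite ler_wpM2r ?linfty_norm_ge0//.
have : (complex.Re `|c^-1|)%:C = ((complex.Re `|c|)^-1)%:C :> R[i].
  by rewrite (fmorphV (real_complex R)) !RRe_real ?normr_real// normfV.
by move=> /complexI ->.
Qed.

Lemma linfty_norm_eq0 a : (linfty_norm a)%:C = 0 :> R[i] -> a = 0.
Proof.
move=> /complexI a0; apply: linftyP => n; apply: rnorm_eq0.
by apply/le_anti; rewrite rnorm_ge0 -a0 linfty_norm_ge.
Qed.

HB.instance Definition _ := Lmodule_isNormed.Build R[i] linfty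
  linfty_normD linfty_normZ linfty_norm_eq0.

Lemma rnorm_linfty a : rnorm a = linfty_norm a.
Proof. by []. Qed.

Fact linfty_complete (F : set_system linfty) :
  ProperFilter F -> cauchy F -> cvg F.
Proof.
move: F; apply: fast_cauchy_complete => u uC.
have H n : {l : A | forall k, rnorm (u k n - l) <= 2 * (2^-1) ^+ k}.
  apply: cid; apply: fast_cauchy_cvg => k.
  exact: le_trans (linfty_norm_ge (u k.+1 - u k) n) (uC k).
pose l n := sval (H n).
have lb : l \in bounded_seq.
  apply/asboolP; exists (2 + linfty_norm (u 0%N)) => n.
  rewrite -[l n](subrK (u 0%N n)); apply: le_trans (rnormD _ _) _.
  rewrite lerD ?linfty_norm_ge// rdistC.
  by have := svalP (H n) 0%N; rewrite expr0 mulr1.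
exists 2, (Linfty lb) => k; rewrite rnorm_linfty; apply/linfty_normP => n.
exact: (svalP (H n)).
Qed.

HB.instance Definition _ := Uniform_isComplete.Build linfty linfty_complete.

Fact linfty_mul_subproof a b : (fun n => cmul (a n) (b n)) \in bounded_seq.
Proof.
apply/asboolP; exists (linfty_norm a * linfty_norm b) => n.
by apply: le_trans (rnormM _ _) _; rewrite ler_pM ?rnorm_ge0 ?linfty_norm_ge.
Qed.
Definition linfty_mul a b : linfty := Linfty (linfty_mul_subproof a b).

Fact linfty_star_subproof a : (fun n => cstar (a n)) \in bounded_seq.
Proof.
by apply/asboolP; exists (linfty_norm a) => n; rewrite rnorm_star linfty_norm_ge.
Qed.
Definition linfty_star a : linfty := Linfty (linfty_star_subproof a).

Fact linfty_mulA : associative linfty_mul.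
Proof. by move=> a b c; apply: linftyP => n /=; rewrite cmulA. Qed.
Fact linfty_mulDl : left_distributive linfty_mul +%R.
Proof. by move=> a b c; apply: linftyP => n /=; rewrite cmulDl. Qed.
Fact linfty_mulDr : right_distributive linfty_mul +%R.
Proof. by move=> a b c; apply: linftyP => n /=; rewrite cmulDr. Qed.
Fact linfty_scaleAl (z : R[i]) a b : z *: linfty_mul a b = linfty_mul (z *: a) b.
Proof. by apply: linftyP => n; exact: cscaleAl. Qed.
Fact linfty_scaleAr (z : R[i]) a b : z *: linfty_mul a b = linfty_mul a (z *: b).
Proof. by apply: linftyP => n; exact: cscaleAr. Qed.
Fact linfty_normM a b : `|linfty_mul a b| <= `|a| * `|b|.
Proof.
rewrite !rnormE -rmorphM/= lecR; apply/linfty_normP => n /=.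
by apply: le_trans (rnormM _ _) _; rewrite ler_pM ?rnorm_ge0 ?linfty_norm_ge.
Qed.
Fact linfty_starK : involutive linfty_star.
Proof. by move=> a; apply: linftyP => n /=; rewrite cstarK. Qed.
Fact linfty_starD : {morph linfty_star : a b / a + b}.
Proof. by move=> a b; apply: linftyP => n /=; rewrite cstarD. Qed.
Fact linfty_starZ (z : R[i]) a : linfty_star (z *: a) = z^* *: linfty_star a.
Proof. by apply: linftyP => n; exact: cstarZ. Qed.
Fact linfty_starM a b :
  linfty_star (linfty_mul a b) = linfty_mul (linfty_star b) (linfty_star a).
Proof. by apply: linftyP => n /=; rewrite cstarM. Qed.
Fact linfty_norm_starM a : `|linfty_mul (linfty_star a) a| = `|a| ^+ 2.
Proof.
rewrite !rnormE -rmorphXn/=; congr (_%:C); apply/le_anti/andP; split.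
  apply/linfty_normP => n /=; rewrite rnorm_starM.
  by rewrite lerXn2r ?nnegrE ?rnorm_ge0// linfty_norm_ge.
rewrite -ler_sqrt ?exprn_ge0 ?rnorm_ge0// sqrtr_sqr ger0_norm ?rnorm_ge0//.
apply/linfty_normP => n.
rewrite -[leLHS]ger0_norm ?rnorm_ge0// -sqrtr_sqr ler_wsqrtr//.
by rewrite -rnorm_starM; exact: (linfty_norm_ge (linfty_mul (linfty_star a) a)).
Qed.

HB.instance Definition _ := CompleteNormedModule_isCStarAlgebra.Build R linfty
  linfty_mulA linfty_mulDl linfty_mulDr linfty_scaleAl linfty_scaleAr
  linfty_normM linfty_starK linfty_starD linfty_starZ linfty_starM
  linfty_norm_starM.

End Linfty.

Structure ultra_on (T : Type) := UltraOn {
  ultra_system :> set_system T;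
  ultra_onP : UltraFilter ultra_system
}.
#[global] Existing Instance ultra_onP.

Definition nonprincipal (T : Type) (U : ultra_on T) : Prop :=
  forall x : T, U <> principal_filter x :> set_system T.

Section Ultrapower.
Variables (R : realType) (U : ultra_on nat) (A : cstarAlgType R).
Implicit Types a b : linfty A.

Definition null_seq : {pred linfty A} :=
  [pred a : linfty A | `[< (`|a n| : R[i]^o) @[n --> ultra_system U] --> (0 : R[i]^o) >]].

Lemma null_seqP a :
  a \in null_seq <-> forall e : R, 0 < e -> ultra_system U [set n | rnorm (a n) < e].
Proof.
split=> [/asboolP/cvg_ballP aU e e0|aU].
  have eC : 0 < e%:C :> R[i] by rewrite ltcR.
  apply: filterS (aU _ eC) => n.
  by rewrite -ball_normE /ball_/= sub0r normrN normr_id rnormE ltcR.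
apply/asboolP/cvg_ballP => e e0.
have er : (complex.Re e)%:C = e by rewrite RRe_real// gtr0_real.
have {}e0 : 0 < complex.Re e by rewrite -ltcR er.
apply: filterS (aU _ e0) => n an; rewrite -er.
by rewrite -ball_normE /ball_/= sub0r normrN normr_id rnormE ltcR.
Qed.

Fact null_seq_submod : submod_closed null_seq.
Proof.
split=> [|c a b /null_seqP aU /null_seqP bU]; apply/null_seqP => e e0.
  by apply: filterE => n /=; rewrite rnorm0.
have c0 := Re_norm_ge0 c.
have d0 : 0 < e / 2 / (complex.Re `|c| + 1) by rewrite !divr_gt0// ltr_wpDl.
have e20 : 0 < e / 2 by rewrite divr_gt0.
apply: filterS2 (aU _ d0) (bU _ e20) => n /= an bn.
apply: le_lt_trans (rnormD _ _) _; rewrite rnormZ [e]splitr ler_ltD//.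
move: an; rewrite ltr_pdivlMr ?ltr_wpDl// => /ltW; apply: le_trans.
by rewrite mulrC ler_wpM2l ?rnorm_ge0// lerDl.
Qed.

HB.instance Definition _ :=
  GRing.isSubmodClosed.Build R[i] (linfty A) null_seq null_seq_submod.

Lemma null_seqMl a b : a \in null_seq -> cmul b a \in null_seq.
Proof.
move=> /null_seqP aU; apply/null_seqP => e e0.
have b0 : 0 < linfty_norm b + 1 by rewrite ltr_wpDl// linfty_norm_ge0.
have d0 : 0 < e / (linfty_norm b + 1) by rewrite divr_gt0.
apply: filterS (aU _ d0) => n /=; rewrite ltr_pdivlMr// => an.
apply: le_lt_trans (rnormM _ _) _; apply: le_lt_trans an; rewrite mulrC.
rewrite ler_wpM2l ?rnorm_ge0//; apply: le_trans (linfty_norm_ge b n) _.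
by rewrite lerDl.
Qed.

Lemma null_seq_star a : a \in null_seq -> cstar a \in null_seq.
Proof.
move=> /null_seqP aU; apply/null_seqP => e e0.
by apply: filterS (aU _ e0) => n /=; rewrite rnorm_star.
Qed.

Lemma null_seqMr a b : a \in null_seq -> cmul a b \in null_seq.
Proof.
move=> /null_seq_star /(null_seqMl (cstar b)) /null_seq_star.
by rewrite cstarM !cstarK.
Qed.

Definition ultrapower := {ideal_quot null_seq}.

HB.instance Definition _ := GRing.Zmodule.on ultrapower.

Implicit Types x y : ultrapower.

Definition ultra_class a : ultrapower := \pi_{ideal_quot null_seq} a.

Lemma ultra_classP a b : ultra_class a = ultra_class b <-> a - b \in null_seq.
Proof.
by rewrite Quotient.idealrBE; split=> [?|/eqP//]; exact/eqP.
Qed.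

Lemma ultra_classK x : ultra_class (repr x) = x.
Proof. exact: reprK. Qed.

Lemma ultra_class_surj x : exists a, ultra_class a = x.
Proof. by exists (repr x); exact: ultra_classK. Qed.

Lemma ultra_classD a b : ultra_class (a + b) = ultra_class a + ultra_class b.
Proof. exact: (raddfD (\pi_{ideal_quot null_seq})). Qed.

Lemma ultra_classB a b : ultra_class (a - b) = ultra_class a - ultra_class b.
Proof. exact: (raddfB (\pi_{ideal_quot null_seq})). Qed.

Lemma ultra_class0 : ultra_class 0 = 0.
Proof. exact: (raddf0 (\pi_{ideal_quot null_seq})). Qed.

Lemma ultra_class_eq0 a : ultra_class a = 0 <-> a \in null_seq.
Proof. by rewrite -ultra_class0 ultra_classP subr0. Qed.

Lemma ultra_repr a : repr (ultra_class a) - a \in null_seq.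
Proof. by apply/ultra_classP; rewrite ultra_classK. Qed.

Definition ultra_scale (z : R[i]) x : ultrapower := ultra_class (z *: repr x).
Definition ultra_mul x y : ultrapower := ultra_class (cmul (repr x) (repr y)).
Definition ultra_star x : ultrapower := ultra_class (cstar (repr x)).

Lemma ultra_scaleE z a : ultra_scale z (ultra_class a) = ultra_class (z *: a).
Proof. by apply/ultra_classP; rewrite -scalerBr rpredZ ?ultra_repr. Qed.

Lemma ultra_mulE a b :
  ultra_mul (ultra_class a) (ultra_class b) = ultra_class (cmul a b).
Proof.
apply/ultra_classP; rewrite -(subrKA (cmul a (repr (ultra_class b)))).
rewrite -cmulBl -cmulBr; apply: rpredD.
  exact/null_seqMr/ultra_repr.
exact/null_seqMl/ultra_repr.
Qed.

Lemma ultra_starE a : ultra_star (ultra_class a) = ultra_class (cstar a).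
Proof. by apply/ultra_classP; rewrite -cstarB null_seq_star ?ultra_repr. Qed.

Fact ultra_scaleA c d x : ultra_scale c (ultra_scale d x) = ultra_scale (c * d) x.
Proof. by rewrite -(ultra_classK x) !ultra_scaleE scalerA. Qed.
Fact ultra_scale1 : left_id 1 ultra_scale.
Proof. by move=> x; rewrite -(ultra_classK x) !ultra_scaleE scale1r. Qed.
Fact ultra_scaleDr : right_distributive ultra_scale +%R.
Proof.
move=> c x y; rewrite -(ultra_classK x) -(ultra_classK y).
by rewrite -ultra_classD !ultra_scaleE -ultra_classD scalerDr.
Qed.
Fact ultra_scaleDl x : {morph ultra_scale^~ x : c d / c + d}.
Proof.
by move=> c d; rewrite -(ultra_classK x) !ultra_scaleE -ultra_classD scalerDl.
Qed.

HB.instance Definition _ := GRing.Zmodule_isLmodule.Build R[i] ultrapower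
  ultra_scaleA ultra_scale1 ultra_scaleDr ultra_scaleDl.

Lemma ultra_classZ z a : ultra_class (z *: a) = z *: ultra_class a.
Proof. by rewrite -ultra_scaleE. Qed.

(* the quotient norm of l^oo(A) / c_U(A) *)
Definition ultra_norm x : R := inf [set rnorm a | a in [set a | ultra_class a = x]].

Lemma ultra_norm_lift x (M : R) : ultra_norm x < M ->
  exists2 a, ultra_class a = x & rnorm a < M.
Proof.
move=> /inf_lt[].
  by exists (rnorm (repr x)); exists (repr x) => //; exact: ultra_classK.
by move=> _ [a ax <-] aM; exists a.
Qed.

Lemma ultra_norm_le x a : ultra_class a = x -> ultra_norm x <= rnorm a.
Proof.
move=> ax; apply: ge_inf; last by exists a.
by exists 0 => _ [b _ <-]; exact: rnorm_ge0.
Qed.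

(* hence ultra_norm (ultra_class a) is also the limit of the norms of a n along U *)
Lemma ultra_normP a (M : R) : ultra_norm (ultra_class a) <= M <->
  forall e, 0 < e -> ultra_system U [set n | rnorm (a n) <= M + e].
Proof.
split=> [aM e e0|aM].
  have e20 : 0 < e / 2 by rewrite divr_gt0.
  have [|b /esym/ultra_classP/null_seqP ab bM] :=
      @ultra_norm_lift (ultra_class a) (M + e / 2).
    by apply: le_lt_trans aM _; rewrite ltrDl.
  apply: filterS (ab _ e20) => n /= abn.
  have := linfty_norm_ge b n; rewrite -rnorm_linfty => bn.
  by rewrite -[a n](subrK (b n)); apply: le_trans (rnormD _ _) _; lra.
apply/ler_addgt0Pr => e e0.
have [m /= am] := filter_ex (aM _ e0).
have Me : 0 <= M + e := le_trans (rnorm_ge0 _) am.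
pose b n := if rnorm (a n) <= M + e then a n else 0.
have bM n : rnorm (b n) <= M + e by rewrite /b; case: ifP => //; rewrite rnorm0.
have bb : b \in @bounded_seq R A by apply/asboolP; exists (M + e).
apply: le_trans (@ultra_norm_le _ (Linfty bb) _) _; last first.
  by rewrite rnorm_linfty; apply/linfty_normP.
apply/ultra_classP/null_seqP => d d0; apply: filterS (aM _ e0) => n /= an.
have bn : b n = a n by rewrite /b an.
by rewrite [X in rnorm X](_ : _ = b n - a n)// bn subrr rnorm0.
Qed.

Lemma ultra_norm_ge0 x : 0 <= ultra_norm x.
Proof.
rewrite -(ultra_classK x); case: leP => // x0.
have /(_ (- ultra_norm (ultra_class (repr x)) / 2)) :=
  (ultra_normP (repr x) _).1 (lexx _).
case/(_ _)/filter_ex; first by lra.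
by move=> n /=; have := rnorm_ge0 (repr x n); lra.
Qed.

Lemma ultra_norm_near a (e : R) : 0 < e ->
  ultra_system U [set n | rnorm (a n) <= ultra_norm (ultra_class a) + e].
Proof. exact: (ultra_normP a _).1. Qed.

Fact ultra_normD x y :
  (ultra_norm (x + y))%:C <= (ultra_norm x)%:C + (ultra_norm y)%:C :> R[i].
Proof.
rewrite -(rmorphD (real_complex R)) lecR.
rewrite -(ultra_classK x) -(ultra_classK y) -ultra_classD.
apply/ultra_normP => e e0; have e20 : 0 < e / 2 by rewrite divr_gt0.
apply: filterS2 (ultra_norm_near (repr x) e20) (ultra_norm_near (repr y) e20).
by move=> n /= xn yn; apply: le_trans (rnormD _ _) _; lra.
Qed.

Fact ultra_normZ (c : R[i]) x :
  (ultra_norm (c *: x))%:C = `|c| * (ultra_norm x)%:C :> R[i].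
Proof.
have H d y : ultra_norm (d *: y) <= complex.Re `|d| * ultra_norm y.
  rewrite -(ultra_classK y) -ultra_classZ.
  apply/ultra_normP => e e0; have d0 := Re_norm_ge0 d.
  have d1 : 0 < complex.Re `|d| + 1 by rewrite ltr_wpDl.
  have ed : 0 < e / (complex.Re `|d| + 1) by rewrite divr_gt0.
  apply: filterS (ultra_norm_near (repr y) ed) => n /= yn; rewrite rnormZ.
  apply: le_trans (ler_wpM2l d0 yn) _; rewrite mulrDr lerD2l mulrCA.
  by rewrite ler_piMr ?(ltW e0)// ler_pdivrMr// mul1r lerDl.
rewrite -[`|c|]RRe_real ?normr_real// -(rmorphM (real_complex R)); congr (_%:C).
apply/le_anti; rewrite H andTb.
have [->|cn0] := eqVneq c 0; first by rewrite normr0 mul0r ultra_norm_ge0.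
have cp : 0 < complex.Re `|c|.
  by rewrite -ltcR RRe_real ?normr_real// normr_gt0.
rewrite -ler_pdivlMl//; apply: le_trans (_ : ultra_norm (c^-1 *: (c *: x)) <= _).
  by rewrite scalerA mulVf// scale1r.
apply: le_trans (H _ _) _; rewrite ler_wpM2r ?ultra_norm_ge0//.
have : (complex.Re `|c^-1|)%:C = ((complex.Re `|c|)^-1)%:C :> R[i].
  by rewrite (fmorphV (real_complex R)) !RRe_real ?normr_real// normfV.
by move=> /complexI ->.
Qed.

Fact ultra_norm_eq0 x : (ultra_norm x)%:C = 0 :> R[i] -> x = 0.
Proof.
move=> /complexI; rewrite -(ultra_classK x) => x0.
apply/ultra_class_eq0/null_seqP => e e0.
have e20 : 0 < e / 2 by rewrite divr_gt0.
apply: filterS (ultra_norm_near (repr x) e20) => n /=; rewrite x0; lra.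
Qed.

HB.instance Definition _ := Lmodule_isNormed.Build R[i] ultrapower
  ultra_normD ultra_normZ ultra_norm_eq0.

Lemma rnorm_ultra x : rnorm x = ultra_norm x.
Proof. by []. Qed.

Fact ultra_complete (F : set_system ultrapower) :
  ProperFilter F -> cauchy F -> cvg F.
Proof.
move: F; apply: fast_cauchy_complete => u uC.
have p0 k : 0 < (2^-1) ^+ k :> R by rewrite exprn_gt0 ?invr_gt0 ?ltr0n.
have H k : {a | ultra_class a = u k.+1 - u k & rnorm a < 2 * (2^-1) ^+ k}.
  apply: cid2; apply: ultra_norm_lift; apply: le_lt_trans (uC k) _.
  by have := p0 k; lra.
pose d k := s2val (H k).
pose s k := repr (u 0%N) + \sum_(i < k) d i.
have su k : ultra_class (s k) = u k.
  elim: k => [|k IH]; first by rewrite /s big_ord0 addr0 ultra_classK.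
  rewrite /s big_ord_recr/= addrA ultra_classD IH (s2valP (H k)).
  by rewrite addrC subrK.
have sd k : rnorm (s k.+1 - s k) < 2 * (2^-1) ^+ k.
  by rewrite /s big_ord_recr/= addrA [_ + d k]addrC addrK; exact: (s2valP' (H k)).
have [k|l sl] := @fast_cauchy_cvg R (linfty A) (fun k => s k.+1).
  by have := sd k.+1; rewrite exprS; lra.
exists 4, (ultra_class l) => k; rewrite -su -ultra_classB rnorm_ultra.
apply: le_trans (@ultra_norm_le _ (s k - l) erefl) _.
case: k => [|k]; last by have := sl k; rewrite exprS; lra.
apply: le_trans (rdistD (s 1%N) _ _) _.
by have := sl 0%N; have := sd 0%N; rewrite rdistC !expr0; lra.
Qed.

HB.instance Definition _ := Uniform_isComplete.Build ultrapower ultra_complete.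

Fact ultra_mulA : associative ultra_mul.
Proof.
move=> x y z; rewrite -(ultra_classK x) -(ultra_classK y) -(ultra_classK z).
by rewrite !ultra_mulE cmulA.
Qed.
Fact ultra_mulDl : left_distributive ultra_mul +%R.
Proof.
move=> x y z; rewrite -(ultra_classK x) -(ultra_classK y) -(ultra_classK z).
by rewrite -ultra_classD !ultra_mulE -ultra_classD cmulDl.
Qed.
Fact ultra_mulDr : right_distributive ultra_mul +%R.
Proof.
move=> x y z; rewrite -(ultra_classK x) -(ultra_classK y) -(ultra_classK z).
by rewrite -ultra_classD !ultra_mulE -ultra_classD cmulDr.
Qed.
Fact ultra_scaleAl (z : R[i]) x y : z *: ultra_mul x y = ultra_mul (z *: x) y.
Proof.
rewrite -(ultra_classK x) -(ultra_classK y) ultra_mulE.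
by rewrite -!ultra_classZ ultra_mulE cscaleAl.
Qed.
Fact ultra_scaleAr (z : R[i]) x y : z *: ultra_mul x y = ultra_mul x (z *: y).
Proof.
rewrite -(ultra_classK x) -(ultra_classK y) ultra_mulE.
by rewrite -!ultra_classZ ultra_mulE cscaleAr.
Qed.
Let ultra_rnormM x y : rnorm (ultra_mul x y) <= rnorm x * rnorm y.
Proof.
rewrite -(ultra_classK x) -(ultra_classK y) ultra_mulE !rnorm_ultra.
set X := ultra_norm (ultra_class (repr x)).
set Y := ultra_norm (ultra_class (repr y)).
have X0 : 0 <= X := ultra_norm_ge0 _; have Y0 : 0 <= Y := ultra_norm_ge0 _.
apply/ultra_normP => e e0.
have XY : 0 < X + Y + 1 by lra.
pose d := Num.min 1 (e / (X + Y + 1)).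
have d0 : 0 < d by rewrite lt_min ltr01 divr_gt0.
have d1 : d <= 1 by rewrite ge_min lexx.
have de : d * (X + Y + 1) <= e by rewrite -ler_pdivlMr// ge_min lexx orbT.
apply: filterS2 (ultra_norm_near (repr x) d0) (ultra_norm_near (repr y) d0).
move=> n /= xn yn; apply: le_trans (rnormM _ _) _.
apply: le_trans (ler_pM (rnorm_ge0 _) (rnorm_ge0 _) xn yn) _.
rewrite -/X -/Y; nra.
Qed.
Fact ultra_normM x y : `|ultra_mul x y| <= `|x| * `|y|.
Proof. by rewrite !rnormE -(rmorphM (real_complex R)) lecR. Qed.
Fact ultra_starK : involutive ultra_star.
Proof. by move=> x; rewrite -(ultra_classK x) !ultra_starE cstarK. Qed.
Fact ultra_starD : {morph ultra_star : x y / x + y}.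
Proof.
move=> x y; rewrite -(ultra_classK x) -(ultra_classK y).
by rewrite -ultra_classD !ultra_starE -ultra_classD cstarD.
Qed.
Fact ultra_starZ (z : R[i]) x : ultra_star (z *: x) = z^* *: ultra_star x.
Proof.
by rewrite -(ultra_classK x) ultra_starE -!ultra_classZ ultra_starE cstarZ.
Qed.
Fact ultra_starM x y :
  ultra_star (ultra_mul x y) = ultra_mul (ultra_star y) (ultra_star x).
Proof.
rewrite -(ultra_classK x) -(ultra_classK y).
by rewrite ultra_mulE !ultra_starE ultra_mulE cstarM.
Qed.
Fact ultra_norm_starM x : `|ultra_mul (ultra_star x) x| = `|x| ^+ 2.
Proof.
rewrite !rnormE -(rmorphXn (real_complex R)); congr (_%:C).
apply/le_anti/andP; split.
  apply: le_trans (ultra_rnormM _ _) _.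
  rewrite expr2 ler_wpM2r ?rnorm_ge0// !rnorm_ultra.
  rewrite -(ultra_classK x) ultra_starE; apply/ultra_normP => e e0.
  by apply: filterS (ultra_norm_near (repr x) e0) => n /=; rewrite rnorm_star.
rewrite !rnorm_ultra -(ultra_classK x) ultra_starE ultra_mulE.
set S := ultra_norm (ultra_class (cmul _ _)); have S0 : 0 <= S := ultra_norm_ge0 _.
rewrite -ler_sqrt// sqrtr_sqr ger0_norm ?ultra_norm_ge0//.
apply/ultra_normP => e e0; have ee : 0 < e ^+ 2 by rewrite exprn_gt0.
apply: filterS (ultra_norm_near (cmul (cstar (repr x)) (repr x)) ee) => n /= xn.
have {}xn : rnorm (repr x n) ^+ 2 <= S + e ^+ 2 by rewrite -rnorm_starM.
have s0 := sqrtr_ge0 S; have ss := sqr_sqrtr S0.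
rewrite -[leLHS]ger0_norm ?rnorm_ge0// -[leRHS]ger0_norm; last by lra.
by rewrite -ler_sqr ?nnegrE ?normr_ge0// !real_normK ?num_real//; nra.
Qed.

HB.instance Definition _ := CompleteNormedModule_isCStarAlgebra.Build R ultrapower
  ultra_mulA ultra_mulDl ultra_mulDr ultra_scaleAl ultra_scaleAr ultra_normM
  ultra_starK ultra_starD ultra_starZ ultra_starM ultra_norm_starM.

End Ultrapower.

Section Traces.
Variables (R : realType) (A : cstarAlgType R).
Implicit Types tau : A -> R[i].

Definition bounded_functional tau : Prop :=
  exists M : R, forall a, `|tau a| <= M%:C * `|a|.

Definition positive_functional tau : Prop :=
  forall a, 0 <= tau (cmul (cstar a) a).

Definition functional_norm tau : R :=
  sup [set complex.Re `|tau a| | a in [set a : A | `|a| <= 1]].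

Definition is_trace tau : Prop :=
  [/\ scalar tau, bounded_functional tau, positive_functional tau
    & forall a b, tau (cmul a b) = tau (cmul b a)].

Definition tracial_state tau : Prop :=
  is_trace tau /\ functional_norm tau = 1.

Definition extremal_tracial_state tau : Prop :=
  tracial_state tau /\
  forall (tau1 tau2 : A -> R[i]) (t : R),
    tracial_state tau1 -> tracial_state tau2 -> 0 < t < 1 ->
    (forall a, tau a = t%:C * tau1 a + (1 - t)%:C * tau2 a) ->
    tau1 = tau /\ tau2 = tau.

End Traces.

Section UltralimitTraces.
Variables (R : realType) (U : ultra_on nat) (A : cstarAlgType R).

Definition is_ultralimit (tau : nat -> A -> R[i]) (phi : ultrapower U A -> R[i]) :
    Prop :=
  forall a : linfty A,
    (tau n (a n) : R[i]^o) @[n --> ultra_system U] --> (phi (ultra_class U a) : R[i]^o).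

Definition is_ultralimit_of_traces (phi : ultrapower U A -> R[i]) : Prop :=
  exists tau : nat -> A -> R[i],
    [/\ forall n, is_trace (tau n),
        exists M : R, forall n, functional_norm (tau n) <= M
      & is_ultralimit tau phi].

End UltralimitTraces.

(* Main.v *)
(* Fix distinct extremal tracial states s_0, s_1, ... of A, write s_k^U for the
   trace on the ultrapower that is the limit of s_k(a_n) along U, and for an
   ultrafilter V on the natural numbers put tau_V = lim_{k -> V} s_k^U.

   Extremal traces are mutually singular, so for every n and every set E of indices
   there is a contraction a in A with s_j(a) close to 1 for j in E and close to 0 for
   j not in E, for all j < n. Sequences of such contractions represent elements on
   which s_k^U is the indicator of E, so distinct V give distinct tau_V, and there are
   2^(2^aleph_0) nonprincipal V. If V is nonprincipal, tau_V is not a limit of traces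
   rho_n: tau_V vanishes on the sequences of contractions b(n, k) interpolating the
   indicator of {0, ..., k - 1}, so a diagonal sequence g(n) tends to infinity along U
   with |rho_n(b(n, g(n)))| < 1/2, whereas s_k^U is 1 on (b(n, g(n)))_n for every k.

   Singularity of two extremal traces s, s' is a Radon-Nikodym argument: if y_k is a
   minimizing sequence for t(y^* y) - 2 Re s(y), t = s + s', then y_k converges to the
   density h of s with respect to t, and lim s'(. y_k), whose density is h(1 - h), is a
   trace dominated by s and by s'. Extremality makes it proportional to both, hence
   zero, so that h is a projection. The approximants y_k become contractions after
   applying 2y/(1 + y^2). As A need not have a unit, closeness of y to 1 for s is
   expressed as |s(z) - s(zy)| <= d s(z^* z)^(1/2) for all z. *)

Require Import Defs.
From mathcomp Require Import all_boot all_order all_algebra complex.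
From mathcomp Require Import ring lra.
From mathcomp Require Import boolp classical_sets functions cardinality filter.
From mathcomp Require Import reals topology normedtype.

Set Implicit Arguments.
Unset Strict Implicit.
Unset Printing Implicit Defensive.

Import Order.TTheory GRing.Theory Num.Theory.
Import numFieldNormedType.Exports.

Local Open Scope classical_set_scope.
Local Open Scope ring_scope.
Local Open Scope complex_scope.

(** * Moduli of complex numbers as real numbers *)

Definition cabs (R : realType) (c : R[i]) : R := complex.Re `|c|.
Arguments cabs : simpl never.

Section Modulus.
Variable R : realType.
Implicit Types c d : R[i].

Lemma cabs_ge0 c : 0 <= cabs c.
Proof. exact: Re_norm_ge0. Qed.

Lemma cabsE c : `|c| = (cabs c)%:C.
Proof. by rewrite /cabs RRe_real ?normr_real. Qed.

Lemma cabsM c d : cabs (c * d) = cabs c * cabs d.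
Proof. by apply/complexI; rewrite rmorphM/= -!cabsE normrM. Qed.

Lemma cabsD c d : cabs (c + d) <= cabs c + cabs d.
Proof. by rewrite -lecR rmorphD/= -!cabsE ler_normD. Qed.

Lemma cabsN c : cabs (- c) = cabs c.
Proof. by rewrite /cabs normrN. Qed.

Lemma cabs0 : cabs (0 : R[i]) = 0.
Proof. by rewrite /cabs normr0. Qed.

Lemma cabs_eq0 c : cabs c = 0 -> c = 0.
Proof. by move=> c0; apply/normr0_eq0; rewrite cabsE c0. Qed.

Lemma cabsR (x : R) : cabs x%:C = `|x|.
Proof. by rewrite /cabs normc_def/= expr0n/= addr0 sqrtr_sqr. Qed.

Lemma cabs_nat n : cabs (n%:R : R[i]) = n%:R.
Proof. by rewrite /cabs normr_nat raddfMn. Qed.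

Lemma cabs_conj c : cabs c^* = cabs c.
Proof. by rewrite /cabs normcJ. Qed.

Lemma cabs_i : cabs ('i%C : R[i]) = 1.
Proof. by rewrite /cabs normc_def/= expr0n expr1n add0r sqrtr1. Qed.

Lemma cabsq c : cabs c ^+ 2 = complex.Re c ^+ 2 + complex.Im c ^+ 2.
Proof. by rewrite /cabs normc_def/= sqr_sqrtr// addr_ge0 ?sqr_ge0. Qed.

Lemma Re_le_cabs c : complex.Re c <= cabs c.
Proof.
apply: le_trans (ler_norm _) _; rewrite -ler_sqr ?nnegrE ?normr_ge0 ?cabs_ge0//.
by rewrite cabsq real_normK ?num_real// lerDl sqr_ge0.
Qed.

End Modulus.

(** * Rational functional calculus of self-adjoint elements *)

Section QuasiInverse.
Variables (R : realType) (A : cstarAlgType R).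
Implicit Types x y g b a s : A.

Lemma half_pow_le0 (r : R) : (forall k, r <= 2 * (2^-1) ^+ k) -> r <= 0.
Proof.
move=> rk; case: leP => // r0.
have [k Hk] : exists k, 2 / r < k%:R.
  by exists (Num.bound (2 / r)); apply: archi_boundP; rewrite divr_ge0// ltW.
have := rk k; rewrite exprVn leNgt => /negP[].
rewrite ltr_pdivrMr ?exprn_gt0// mulrC -ltr_pdivrMr//.
by apply: lt_trans Hk _; rewrite -natrX ltr_nat ltn_expl.
Qed.

Lemma half_contraction_eq0 x : rnorm x <= 2^-1 * rnorm x -> x = 0.
Proof. by move=> H; apply: rnorm_eq0; have := rnorm_ge0 x; lra. Qed.

Lemma half_contraction_fix (L : A -> A) b :
  {morph L : x z / x - z} -> (forall x, rnorm (L x) <= 2^-1 * rnorm x) ->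
  rnorm b <= 1 -> exists x, x = b + L x.
Proof.
move=> LB Lh b1; pose u k := iter k (fun x => b + L x) 0.
have uS k : u k.+1 = b + L (u k) by [].
have L0 : L 0 = 0 by have := LB 0 0; rewrite !subrr.
have ud k : rnorm (u k.+1 - u k) <= (2^-1) ^+ k.
  elim: k => [|k IH]; first by rewrite uS L0 addr0 subr0 expr0.
  rewrite (uS k.+1) {2}uS opprD addrACA subrr add0r -LB.
  by apply: le_trans (Lh _) _; rewrite exprS ler_pM2l ?invr_gt0.
have [l ul] := fast_cauchy_cvg ud.
exists l; apply/eqP; rewrite -subr_eq0; apply/eqP/rnorm_eq0/le_anti.
rewrite rnorm_ge0 andbT; apply: half_pow_le0 => k.
apply: le_trans (rdistD (u k.+1) _ _) _.
have -> : u k.+1 - (b + L l) = L (u k - l).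
  by rewrite uS opprD addrACA subrr add0r LB.
rewrite rdistC; have := ul k.+1; have := Lh (u k - l); have := ul k; rewrite exprS; lra.
Qed.

(* [g = y^2 (1 + y^2)^-1], which makes sense without a unit. *)
Definition quasi y g := [/\ cstar g = g, cmul y g = cmul g y
  & g + cmul (cmul y y) g = cmul y y].

Lemma cstarZc (z : R[i]) x : cstar (z *: x) = conjc z *: cstar x.
Proof. exact: cstarZ. Qed.

Lemma cmulr0 x : cmul x 0 = 0.
Proof. by rewrite -[X in cmul _ X](scale0r (0 : A)) -cscaleAr scale0r. Qed.

(* The hypothesis says that 1 - k is an isometry in the unitization. *)
Lemma rnorm_sub_unitary (k : A) x : cmul (cstar k) k = k + cstar k ->
  rnorm (x - cmul k x) = rnorm x.
Proof.
move=> kk; apply/eqP; rewrite -(@eqrXn2 _ 2) ?rnorm_ge0// -!rnorm_starM.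
apply/eqP; congr rnorm; rewrite cstarB cstarM cmulBl !cmulBr.
rewrite -[in X in _ - (_ - X)]cmulA [cmul (cstar k) _]cmulA kk cmulDl cmulDr -!cmulA.
by rewrite opprB addrK subrK.
Qed.



Lemma quasiN y g : quasi y g -> quasi (- y) g.
Proof.
move=> [gs yg yyg]; split=> //; first by rewrite cmulNl cmulNr yg.
by rewrite cmulNl cmulNr opprK.
Qed.

Section Quasi.
Variables (y g : A).
Hypotheses (ys : cstar y = y) (yg : quasi y g).

Let v := y - cmul y g.
(** In the unitization [v] is y (1 + y^2)^-1 and 1 - k is the Cayley transform (1 + iy)(1 - iy)^-1.
    Its unitarity, which is [quasi_kk], is the source of all norm bounds on [g] and [v]. *)
Let k : A := 2 *: g - (2 * 'i) *: v.

Lemma quasi_imag_star : cstar v = v.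
Proof. by have [gs c _] := yg; rewrite /v cstarB cstarM gs ys c. Qed.

Lemma quasi_imag_comm : cmul g v = cmul v g.
Proof. by have [gs c _] := yg; rewrite /v cmulBl cmulBr cmulA -c. Qed.

(** This is y^4 + y^2 = y^2 (1 + y^2), divided by (1 + y^2)^2. *)
Lemma quasi_imag_sqr : cmul g g + cmul v v = g.
Proof.
have [gs c e] := yg.
have yv : cmul y v = g by rewrite /v cmulBr cmulA -{1}e addrK.
have -> : cmul v v = cmul y v - cmul g (cmul y v).
  by rewrite {1}/v cmulBl c -cmulA.
by rewrite yv addrC subrK.
Qed.

Lemma quasi_kstar : cstar k = 2 *: g + (2 * 'i) *: v.
Proof.
have [gs _ _] := yg.
have c2 : conjc 2 = 2 :> R[i] by exact: conjc_nat.
have c2i : conjc (2 * 'i%C) = - (2 * 'i%C) :> R[i].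
  by apply/eqP; rewrite eq_complex/=; apply/andP; split; apply/eqP; ring.
by rewrite /k cstarB !cstarZc gs quasi_imag_star c2 c2i scaleNr opprK.
Qed.

Lemma quasi_kD : k + cstar k = 4 *: g.
Proof. by rewrite quasi_kstar /k addrC addrACA addrN addr0 -scalerDl; congr (_ *: _); ring. Qed.

Lemma quasi_kB : cstar k - k = (4 * 'i) *: v.
Proof.
rewrite quasi_kstar /k opprB [2 *: g + _]addrC addrACA subrr addr0 -scalerDl; congr (_ *: _); ring.
Qed.

Lemma quasi_kk : cmul (cstar k) k = k + cstar k.
Proof.
have ii : ('i * 'i = -1 :> R[i])%C by rewrite -expr2 sqr_i.
rewrite quasi_kD quasi_kstar /k cmulBr !cmulDl -!cscaleAl -!cscaleAr !scalerA.
rewrite quasi_imag_comm [2 * (2 * 'i)]mulrC opprD addrA addrK -scaleNr.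
have -> : - (2 * 'i * (2 * 'i)) = 4 :> R[i] by rewrite mulrACA ii; ring.
by rewrite -natrM -scalerDr quasi_imag_sqr.
Qed.


Lemma quasi_rnormU x : rnorm (x - cmul k x) = rnorm x.
Proof. exact: rnorm_sub_unitary quasi_kk. Qed.

End Quasi.

Lemma rnormZc c x : rnorm (c *: x) = cabs c * rnorm x.
Proof. exact: rnormZ. Qed.

Lemma rnormZR (c : R) x : rnorm (c%:C *: x) = `|c| * rnorm x.
Proof. by rewrite rnormZc cabsR. Qed.

Lemma rnormZn n x : rnorm (n%:R *: x) = n%:R * rnorm x.
Proof. by rewrite rnormZc cabs_nat. Qed.

Section QuasiBounds.
Variables (y g x : A).
Hypotheses (ys : cstar y = y) (yg : quasi y g).

Let v := y - cmul y g.
Let k : A := 2 *: g - (2 * 'i) *: v.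

Let xk : rnorm (x - cmul k x) = rnorm x.
Proof. exact: quasi_rnormU. Qed.

(** Passing from y to -y keeps [g] and exchanges [k] with its adjoint. *)
Let xks : rnorm (x - cmul (cstar k) x) = rnorm x.
Proof.
have yNs : cstar (- y) = - y by rewrite cstarN ys.
rewrite quasi_kstar// -[RHS](quasi_rnormU yNs (quasiN yg)).
by rewrite cmulNl -opprD scalerN opprK.
Qed.

Let x2 : x + x = 2 *: x.
Proof. by rewrite scaler_nat mulr2n. Qed.

(** Since 4 g = 2 - (1 - k) - (1 - cstar k) and both brackets act isometrically, 4 g x has norm at
    most 2 + 1 + 1 times that of x. The next two bounds use 4 (1 - g) = 2 + (1 - k) + (1 - cstar k)
    and 4 i v = (1 - k) - (1 - cstar k) in the same way. *)
Lemma quasi_le : rnorm (cmul g x) <= rnorm x.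
Proof.
rewrite -(@ler_pM2l _ 4)// -rnormZn cscaleAl -(quasi_kD ys yg) -/v -/k.
have -> : cmul (k + cstar k) x = 2 *: x - (x - cmul k x) - (x - cmul (cstar k) x).
  by rewrite -[RHS]addrA -opprD [X in _ - X]addrACA -opprD x2 opprB [RHS]addrC subrK cmulDl.
apply: le_trans (rnormD _ _) _; rewrite rnormN xks.
have := rnormD (2 *: x) (- (x - cmul k x)); rewrite rnormN xk rnormZn; lra.
Qed.

Lemma quasi_le_sub : rnorm (x - cmul g x) <= rnorm x.
Proof.
rewrite -(@ler_pM2l _ 4)// -rnormZn scalerBr cscaleAl -(quasi_kD ys yg) -/v -/k.
have -> : 4 *: x - cmul (k + cstar k) x =
    2 *: x + ((x - cmul k x) + (x - cmul (cstar k) x)).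
  rewrite addrACA -opprD -cmulDl x2 addrA -scalerDl.
  by congr (_ *: _ - _); ring.
apply: le_trans (rnormD _ _) _; rewrite rnormZn.
have := rnormD (x - cmul k x) (x - cmul (cstar k) x); rewrite xk xks; lra.
Qed.

Lemma quasi_le_imag : rnorm (cmul v x) <= 2^-1 * rnorm x.
Proof.
rewrite -(@ler_pM2l _ 4)//.
have -> : 4 * rnorm (cmul v x) = rnorm (cmul (cstar k - k) x).
  by rewrite quasi_kB// -cscaleAl rnormZc cabsM cabs_nat cabs_i mulr1.
have -> : cmul (cstar k - k) x = (x - cmul k x) - (x - cmul (cstar k) x).
  by rewrite cmulBl opprB [RHS]addrC addrA subrK.
apply: le_trans (rnormD _ _) _; rewrite rnormN xk xks; lra.
Qed.

End QuasiBounds.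

Lemma quasi_rnorm y g : cstar y = y -> quasi y g -> rnorm g <= 1.
Proof.
move=> ys yg; have := quasi_le g ys yg; have [gs _ _] := yg.
rewrite -{1}gs rnorm_starM; have := rnorm_ge0 g; nra.
Qed.

Lemma quasi_rnorm_imag y g : cstar y = y -> quasi y g ->
  rnorm (y - cmul y g) <= 2^-1.
Proof.
move=> ys yg; have := quasi_le_imag (y - cmul y g) ys yg.
rewrite -{1}(quasi_imag_star ys yg) rnorm_starM; have := rnorm_ge0 (y - cmul y g); nra.
Qed.

Section AffineFix.
Variables (c : R[i]) (m b : A).
Hypotheses (cr : conjc c = c) (ms : cstar m = m) (bs : cstar b = b).
Hypotheses (mb : cmul m b = cmul b m) (b1 : rnorm b <= 1).

Let L x := c *: x - cmul m x.
Hypothesis Lh : forall x, rnorm (L x) <= 2^-1 * rnorm x.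

(** The equation (1 - c + m) g = b is solved by iterating a half-contraction. Uniqueness yields the
    rest: the adjoint of g solves the same equation, and z g - g z is fixed by the linear part [L],
    hence zero. *)
Lemma affine_fix : exists g, [/\ g = b + (c *: g - cmul m g), cstar g = g
  & forall z, cmul z b = cmul b z -> cmul z m = cmul m z -> cmul z g = cmul g z].
Proof.
have LB : {morph L : x z / x - z}.
  move=> x z; rewrite /L scalerBr cmulBr !opprB addrACA [RHS]addrACA.
  by rewrite [- (c *: z) - _]addrC.
have [g gE] := half_contraction_fix LB Lh b1.
have uniq x z : x - z = L x - L z -> x = z.
  move=> xz; apply/eqP; rewrite -subr_eq0; apply/eqP/half_contraction_eq0.
  by rewrite {1}xz -LB Lh.
have comm z : cmul z b = cmul b z -> cmul z m = cmul m z -> cmul z g = cmul g z.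
  move=> zb zm; apply: uniq.
  rewrite {1 2}gE cmulDl cmulDr zb opprD addrACA subrr add0r.
  by rewrite /L cmulBr cmulBl -cscaleAr -cscaleAl cmulA zm -!cmulA.
exists g; split=> //.
have gm : cmul (cstar g) m = cmul m (cstar g).
  by rewrite -{1}ms -cstarM comm// cstarM ms.
apply: uniq; rewrite {1 2}gE cstarD bs opprD addrACA subrr add0r.
by rewrite /L cstarB cstarZc cr cstarM ms gm.
Qed.

End AffineFix.

Let small_quasi y : cstar y = y -> rnorm (cmul y y) <= 2^-1 -> exists g, quasi y g.
Proof.
move=> ys y2; have yys : cstar (cmul y y) = cmul y y by rewrite cstarM ys.
have [|||x|g [gE gs gc]] := @affine_fix 0 _ _ _ yys yys.
- exact: conjc0.
- by [].
- lra.
- rewrite scale0r sub0r rnormN; apply: le_trans (rnormM _ _) _.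
  by rewrite ler_wpM2r ?rnorm_ge0.
exists g; split=> //; first by apply: gc; rewrite cmulA.
by rewrite {1}gE scale0r sub0r subrK.
Qed.

(* [2 y^2 (1 + 2 y^2)^-1 = 2 g (1 + g)^-1] for [g = y^2 (1 + y^2)^-1]. *)
Let double_quasi y z g : cstar y = y -> quasi y g -> cmul z z = 2 *: cmul y y ->
  cmul z g = cmul g z -> exists h, quasi z h.
Proof.
move=> ys yg zz zg; have [gs _ e2] := yg; set p := cmul y y in zz e2.
have c2 : conjc (2^-1) = 2^-1 :> R[i] by rewrite conjc_inv conjc_nat.
have cabs2 : cabs (2^-1 : R[i]) = 2^-1.
  have -> : (2^-1 : R[i]) = (2^-1 : R)%:C by rewrite fmorphV rmorph_nat.
  by rewrite cabsR ger0_norm ?invr_ge0.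
(* The equation (1 + g) h = 2 g is rewritten as h = g + (1 - g) h / 2, whose linear part is a
   half-contraction by [quasi_le_sub]. *)
have [|||||x|h [hE hs hc]] := @affine_fix (2^-1) (2^-1 *: g) g.
- exact: c2.
- by rewrite cstarZc gs c2.
- exact: gs.
- by rewrite -cscaleAl cscaleAr.
- exact: quasi_rnorm yg.
- rewrite -cscaleAl -scalerBr rnormZc cabs2 ler_wpM2l ?invr_ge0//.
  exact: quasi_le_sub yg.
exists h; split=> //; first by apply: hc; rewrite // -cscaleAr -cscaleAl zg.
have e1 : h = 2 *: g - cmul g h.
  have := congr1 (fun x => 2 *: x - h) hE.
  rewrite -cscaleAl -scalerBr scalerDr scalerA mulfV ?pnatr_eq0// scale1r.
  rewrite scaler_nat mulr2n addrK => {1}->.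
  by rewrite -[LHS]addrA [h - _]addrC addrK.
have pg : cmul p g = p - g by rewrite -{2}e2 addrC addKr.
have e : cmul p h = 2 *: (p - g) - (cmul p h - cmul g h).
  by rewrite {1}e1 cmulBr -cscaleAr cmulA pg cmulBl.
rewrite zz -cscaleAl -/p [2 *: cmul p h]scaler_nat mulr2n {1}e opprB -addrA subrK.
have -> : 2 *: (p - g) + cmul g h = 2 *: p - h.
  by rewrite [X in _ = _ - X]e1 scalerBr opprB -addrA [- _ + _]addrC.
by rewrite addrC subrK.
Qed.

(** Induction on n with 2^(n-1) bounding the norm of y^2: dividing y by the square root of 2 lowers
    n by one, and [double_quasi] goes back up. *)
Lemma quasi_exists y : cstar y = y -> exists g, quasi y g.
Proof.
have [n] : exists n : nat, rnorm (cmul y y) <= 2^-1 * 2 ^+ n.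
  exists (Num.bound (2 * rnorm (cmul y y))); rewrite -ler_pdivrMl ?invr_gt0// invrK.
  apply: ltW; apply: lt_trans (archi_boundP _) _; first by rewrite mulr_ge0 ?rnorm_ge0.
  by rewrite -natrX ltr_nat ltn_expl.
elim: n y => [|n IH] y yn ys; first by apply: small_quasi; rewrite // -[leRHS]mulr1.
pose r : R := Num.sqrt 2; have r0 : 0 < r by rewrite sqrtr_gt0.
have rr : r * r = 2 by rewrite -expr2 sqr_sqrtr.
pose z := (r^-1)%:C *: y.
have zs : cstar z = z by rewrite cstarZc conjc_real ys.
have zz : cmul y y = 2 *: cmul z z.
  rewrite /z -cscaleAl -cscaleAr !scalerA.
  rewrite -[2]/((2 : nat)%:R) -(rmorph_nat (real_complex R)) -!rmorphM/= -rr.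
  by rewrite [X in X%:C](_ : _ = 1) ?scale1r//; field; rewrite gt_eqF.
have [|//|g zg] := IH z.
  have := yn; rewrite zz rnormZn exprS; have := rnorm_ge0 (cmul z z); nra.
have [_ c _] := zg; apply: double_quasi zg zz _ => //.
have -> : y = r%:C *: z.
  by rewrite /z scalerA -rmorphM/= mulfV ?gt_eqF// scale1r.
by rewrite -cscaleAl -cscaleAr c.
Qed.

(** For y = s / e and u = g, s (1 - u) = e y (1 + y^2)^-1 has norm at most e / 2, and multiplication
    by 1 - u does not increase it. *)
Lemma approx_unit_sandwich s (e : R) : cstar s = s -> 0 < e ->
  exists u, [/\ cstar u = u, rnorm u <= 1
    & rnorm (s - cmul s u - cmul u (s - cmul s u)) <= e].
Proof.
move=> ss e0; pose y := (e^-1)%:C *: s.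
have ys : cstar y = y by rewrite cstarZc conjc_real ss.
have sy : s = e%:C *: y by rewrite scalerA -rmorphM/= mulfV ?gt_eqF// scale1r.
have [g yg] := quasi_exists ys; have [gs _ _] := yg.
exists g; split=> //; first exact: quasi_rnorm yg.
rewrite sy -cscaleAl -scalerBr -cscaleAr -scalerBr rnormZR gtr0_norm//.
rewrite ler_piMr ?(ltW e0)//; apply: le_trans (quasi_le_sub _ ys yg) _.
by apply: le_trans (quasi_rnorm_imag ys yg) _; lra.
Qed.

(** By the C*-identity, the squared norm of (1 - u) a is the norm of (1 - u) s (1 - u) for s = a
    (cstar a). *)
Lemma approx_unit a (e : R) : 0 < e ->
  exists u, [/\ cstar u = u, rnorm u <= 1 & rnorm (a - cmul u a) <= e].
Proof.
move=> e0; have ss : cstar (cmul a (cstar a)) = cmul a (cstar a) by rewrite cstarM cstarK.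
have [|u [us u1 ue]] := approx_unit_sandwich (e := e ^+ 2) ss; first by rewrite exprn_gt0.
exists u; split=> //; rewrite -ler_sqr ?nnegrE ?rnorm_ge0 ?(ltW e0)//.
rewrite -rnorm_star -rnorm_starM cstarK cstarB cstarM us.
by rewrite cmulBl -[cmul (cmul u a) _]cmulA cmulBr [cmul a (cmul _ u)]cmulA.
Qed.

End QuasiInverse.

(** * Real parts, a discriminant inequality and the norm of a functional *)

Section ReIm.
Variable R : realType.
Implicit Types c d : R[i].

Lemma cReD c d : complex.Re (c + d) = complex.Re c + complex.Re d.
Proof. by case: c; case: d. Qed.

Lemma cImD c d : complex.Im (c + d) = complex.Im c + complex.Im d.
Proof. by case: c; case: d. Qed.

Lemma cReN c : complex.Re (- c) = - complex.Re c.
Proof. by case: c. Qed.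

Lemma cReB c d : complex.Re (c - d) = complex.Re c - complex.Re d.
Proof. by rewrite cReD cReN. Qed.

Lemma cReR (x : R) : complex.Re x%:C = x.
Proof. by []. Qed.

Lemma cReMr (x : R) c : complex.Re (x%:C * c) = x * complex.Re c.
Proof. by case: c => a b /=; rewrite mul0r subr0. Qed.

Lemma cRe_conj c : complex.Re (conjc c) = complex.Re c.
Proof. by case: c. Qed.

Lemma conjcM_cabs c : conjc c * c = (cabs c ^+ 2)%:C.
Proof.
case: c => a b; rewrite cabsq/=; apply/eqP; rewrite eq_complex/=.
by apply/andP; split; apply/eqP; ring.
Qed.

(** It serves both Cauchy-Schwarz and the first-order condition at an approximate minimum. Only the
    values c = - t (conjc b) with t real are tested. *)
Lemma quad_discr (a d : R) (b : R[i]) : 0 <= d ->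
  (forall c, 0 <= a + 2 * complex.Re (c * b) + cabs c ^+ 2 * d) ->
  cabs b ^+ 2 <= a * d.
Proof.
move=> d0 H.
have Ht (t : R) : 0 <= a - 2 * t * cabs b ^+ 2 + t ^+ 2 * cabs b ^+ 2 * d.
  have := H ((- t)%:C * conjc b).
  rewrite -mulrA conjcM_cabs cReMr cReR cabsM cabsR cabs_conj exprMn.
  by rewrite real_normK ?num_real//; lra.
have a0 : 0 <= a by have := Ht 0; rewrite mulr0 mul0r subr0 expr0n !mul0r addr0.
have b0 : 0 <= cabs b ^+ 2 by rewrite sqr_ge0.
move: d0; rewrite le_eqVlt => /orP[/eqP d0|d0].
  have [->|bn] := eqVneq (cabs b ^+ 2) 0; first by rewrite -d0 mulr0.
  (* With d = 0 the expression is affine in t; this t makes it - a - 2, which is negative. *)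
  have := Ht ((a + 1) / cabs b ^+ 2); rewrite -d0 mulr0 addr0.
  by rewrite -[2 * _ * _]mulrA divfK//; lra.
(* The minimum over t is attained at 1 / d. *)
have := Ht d^-1; have dn : d != 0 by rewrite gt_eqF.
have -> : a - 2 * d^-1 * cabs b ^+ 2 + d^-1 ^+ 2 * cabs b ^+ 2 * d =
  (a * d - cabs b ^+ 2) / d by field.
by rewrite pmulr_lge0 ?invr_gt0// subr_ge0.
Qed.

End ReIm.

Section FunctionalNorm.
Variables (R : realType) (A : cstarAlgType R) (f : A -> R[i]).
Implicit Types a b : A.

Lemma rnorm_le1 a : (`|a| <= 1) = (rnorm a <= 1).
Proof. by rewrite rnormE -[1]/(1%:C) lecR. Qed.

Section Scalar.
Hypothesis fs : scalar f.

Lemma functional0 : f 0 = 0.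
Proof. by have := fs (-1) 0 0; rewrite scaler0 addr0 /= => ->; rewrite mulN1r addNr. Qed.

Lemma functionalD a b : f (a + b) = f a + f b.
Proof. by have := fs 1 a b; rewrite scale1r /= => ->; rewrite mul1r. Qed.

Lemma functionalZ c a : f (c *: a) = c * f a.
Proof. by have := fs c a 0; rewrite addr0 /= => ->; rewrite functional0 addr0. Qed.

Lemma functionalN a : f (- a) = - f a.
Proof. by rewrite -scaleN1r functionalZ mulN1r. Qed.

Lemma functionalB a b : f (a - b) = f a - f b.
Proof. by rewrite functionalD functionalN. Qed.

End Scalar.

Lemma functional_boundedP : bounded_functional f <->
  exists M : R, forall a, cabs (f a) <= M * rnorm a.
Proof.
split=> -[M fM]; exists M => a; have := fM a.
  by rewrite cabsE rnormE -(rmorphM (real_complex R)) lecR.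
by rewrite cabsE [`|a|]rnormE -(rmorphM (real_complex R)) lecR.
Qed.

Lemma functional_norm_le (M : R) : (forall a, rnorm a <= 1 -> cabs (f a) <= M) ->
  functional_norm f <= M.
Proof.
move=> fM; apply: ge_sup; first by exists (cabs (f 0)); exists 0; rewrite //= normr0.
by move=> _ [a /= a1 <-]; apply: fM; rewrite -rnorm_le1.
Qed.

Lemma functional_norm_approx (e : R) : 0 < e -> bounded_functional f ->
  exists2 a, rnorm a <= 1 & functional_norm f - e < cabs (f a).
Proof.
move=> e0 /functional_boundedP[M fM].
have [|_ [a /= a1 <-] ?] := @sup_adherent _ _ _ e0 (_ : has_sup
  [set complex.Re `|f a| | a in [set a : A | `|a| <= 1]]).
  split; first by exists (cabs (f 0)); exists 0; rewrite //= normr0.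
  exists `|M| => _ [a /= + <-]; rewrite rnorm_le1 => a1; apply: le_trans (fM a) _.
  by have := ler_norm M; have := rnorm_ge0 a; have := normr_ge0 M; nra.
by exists a => //; rewrite -rnorm_le1.
Qed.

Hypotheses (fs : scalar f) (fb : bounded_functional f).

Lemma functional_norm_ub1 a : rnorm a <= 1 -> cabs (f a) <= functional_norm f.
Proof.
move=> a1; apply: ub_le_sup; last by exists a; rewrite //= rnorm_le1.
have [M fM] := functional_boundedP.1 fb.
exists `|M| => _ [b /= + <-]; rewrite rnorm_le1 => b1; apply: le_trans (fM b) _.
by have := ler_norm M; have := rnorm_ge0 b; have := normr_ge0 M; nra.
Qed.

Lemma functional_norm_ge0 : 0 <= functional_norm f.
Proof.
by apply: le_trans (functional_norm_ub1 (a := 0) _); rewrite ?cabs_ge0 ?rnorm0.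
Qed.

Lemma functional_norm_ub a : cabs (f a) <= functional_norm f * rnorm a.
Proof.
have [a0|an] := eqVneq (rnorm a) 0.
  by rewrite a0 mulr0 (rnorm_eq0 a0) functional0// cabs0.
have a0 : 0 < rnorm a by rewrite lt_def an rnorm_ge0.
have := @functional_norm_ub1 ((rnorm a)^-1%:C *: a).
rewrite rnormZR functionalZ// cabsM cabsR gtr0_norm ?invr_gt0// mulVf// => /(_ (lexx _)).
by rewrite mulrC ler_pdivrMr.
Qed.

End FunctionalNorm.

(** * Positive functionals and traces *)

Definition sqn (R : realType) (A : cstarAlgType R) (f : A -> R[i]) (x : A) : R :=
  complex.Re (f (cmul (cstar x) x)).

Definition nrm (R : realType) (A : cstarAlgType R) (f : A -> R[i]) (x : A) : R :=
  Num.sqrt (sqn f x).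

Section PositiveForm.
Variables (R : realType) (A : cstarAlgType R) (f : A -> R[i]).
Hypotheses (fs : scalar f) (fp : positive_functional f).
Implicit Types x y z : A.

Lemma sqn_ge0 x : 0 <= sqn f x.
Proof. by have := fp x; rewrite lecE => /andP[]. Qed.

Lemma sqnE x : f (cmul (cstar x) x) = (sqn f x)%:C.
Proof. by rewrite /sqn RRe_real// ger0_real// fp. Qed.

Lemma sqnZ c x : sqn f (c *: x) = cabs c ^+ 2 * sqn f x.
Proof.
rewrite /sqn cstarZc -cscaleAl -cscaleAr !functionalZ// mulrA conjcM_cabs.
by rewrite cReMr.
Qed.

Lemma sqnN x : sqn f (- x) = sqn f x.
Proof. by rewrite -scaleN1r sqnZ cabsN -[1]/(1%:C) cabsR normr1 expr1n mul1r. Qed.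

Let expand x y : f (cmul (cstar (x + y)) (x + y)) = (sqn f x)%:C + (sqn f y)%:C
  + (f (cmul (cstar x) y) + f (cmul (cstar y) x)).
Proof.
rewrite cstarD cmulDl !cmulDr !functionalD// !sqnE.
by rewrite [X in _ + X]addrC addrACA.
Qed.

Lemma form_conj x y : f (cmul (cstar y) x) = conjc (f (cmul (cstar x) y)).
Proof.
have real z w : complex.Im (f (cmul (cstar z) w) + f (cmul (cstar w) z)) = 0.
  have := expand z w; rewrite sqnE => /(congr1 (@complex.Im _)).
  by rewrite !cImD/= !add0r => <-.
have r1 := real x y; have := real x ('i%C *: y).
rewrite cstarZc -cscaleAl -cscaleAr !functionalZ//.
move: r1; case: (f _) => a b; case: (f _) => c d /= r1 r2.
by apply/eqP; rewrite eq_complex/=; apply/andP; split; apply/eqP; lra.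
Qed.

Lemma sqnD x y :
  sqn f (x + y) = sqn f x + sqn f y + 2 * complex.Re (f (cmul (cstar x) y)).
Proof. by rewrite {1}/sqn expand !cReD (form_conj x y) cRe_conj !cReR; lra. Qed.

Lemma form_CS x y : cabs (f (cmul (cstar x) y)) ^+ 2 <= sqn f x * sqn f y.
Proof.
apply: quad_discr; first exact: sqn_ge0.
move=> c; have := sqn_ge0 (x + c *: y).
by rewrite sqnD sqnZ -cscaleAr functionalZ//; lra.
Qed.

Lemma nrm_ge0 x : 0 <= nrm f x.
Proof. exact: sqrtr_ge0. Qed.

Lemma sqr_nrm x : nrm f x ^+ 2 = sqn f x.
Proof. by rewrite sqr_sqrtr// sqn_ge0. Qed.

Lemma nrm_le x (M : R) : 0 <= M -> sqn f x <= M ^+ 2 -> nrm f x <= M.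
Proof. by move=> M0; rewrite -sqr_nrm ler_sqr ?nnegrE// nrm_ge0. Qed.

Lemma form_le x y : cabs (f (cmul (cstar x) y)) <= nrm f x * nrm f y.
Proof.
rewrite -ler_sqr ?nnegrE ?mulr_ge0 ?nrm_ge0 ?cabs_ge0//.
by rewrite exprMn !sqr_nrm form_CS.
Qed.

Lemma nrmZ c x : nrm f (c *: x) = cabs c * nrm f x.
Proof.
by rewrite /nrm sqnZ sqrtrM ?sqr_ge0// sqrtr_sqr ger0_norm ?cabs_ge0.
Qed.

Lemma nrmN x : nrm f (- x) = nrm f x.
Proof. by rewrite /nrm sqnN. Qed.

Lemma nrmD x y : nrm f (x + y) <= nrm f x + nrm f y.
Proof.
apply: nrm_le; first by rewrite addr_ge0 ?nrm_ge0.
rewrite sqnD sqrrD !sqr_nrm; have := form_le x y.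
have := Re_le_cabs (f (cmul (cstar x) y)); lra.
Qed.

Lemma nrmB x y : nrm f (x - y) <= nrm f x + nrm f y.
Proof. by rewrite -(nrmN y) nrmD. Qed.

Hypothesis fb : bounded_functional f.

(* The norm [N] of [c |-> f (x^* c x)] satisfies [N^2 <= sqn f x * N] by
   Cauchy-Schwarz, hence [N <= sqn f x]. *)
Lemma form_sandwich_le x c :
  cabs (f (cmul (cstar x) (cmul c x))) <= sqn f x * rnorm c.
Proof.
pose g c := f (cmul (cstar x) (cmul c x)).
have gs : scalar g.
  by move=> k a b; rewrite /g cmulDl cmulDr functionalD// -cscaleAl -cscaleAr functionalZ.
have gb : bounded_functional g.
  have [M fM] := (functional_boundedP f).1 fb.
  apply/functional_boundedP; exists (`|M| * rnorm x ^+ 2) => a.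
  apply: le_trans (fM _) _.
  apply: le_trans (ler_wpM2r (rnorm_ge0 _) (ler_norm M)) _.
  rewrite -mulrA ler_wpM2l//; apply: le_trans (rnormM _ _) _.
  by rewrite rnorm_star expr2 -mulrA ler_wpM2l ?rnorm_ge0// [leRHS]mulrC rnormM.
suff gN : functional_norm g <= sqn f x.
  apply: le_trans (functional_norm_ub gs gb c) _.
  by rewrite ler_wpM2r ?rnorm_ge0.
have N0 := functional_norm_ge0 gb.
have sN : 0 <= sqn f x * functional_norm g by rewrite mulr_ge0 ?sqn_ge0.
have : functional_norm g <= Num.sqrt (sqn f x * functional_norm g).
  apply: functional_norm_le => a a1.
  rewrite -ler_sqr ?nnegrE ?sqrtr_ge0 ?cabs_ge0// sqr_sqrtr//.
  apply: le_trans (form_CS _ _) _; rewrite ler_wpM2l ?sqn_ge0//.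
  apply: le_trans (Re_le_cabs _) _; rewrite cstarM -cmulA [cmul (cstar a) _]cmulA.
  apply: (functional_norm_ub1 gb); rewrite rnorm_starM.
  by have := rnorm_ge0 a; nra.
rewrite -ler_sqr ?nnegrE ?sqrtr_ge0// sqr_sqrtr//.
have := sqn_ge0 x; nra.
Qed.

Lemma sqnM_le b x : sqn f (cmul b x) <= rnorm b ^+ 2 * sqn f x.
Proof.
rewrite {1}/sqn cstarM -cmulA [cmul (cstar b) _]cmulA -rnorm_starM mulrC.
by apply: le_trans (Re_le_cabs _) _; exact: form_sandwich_le.
Qed.

Lemma nrmM_le b x : nrm f (cmul b x) <= rnorm b * nrm f x.
Proof.
apply: nrm_le; first by rewrite mulr_ge0 ?nrm_ge0 ?rnorm_ge0.
by rewrite exprMn sqr_nrm sqnM_le.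
Qed.

Lemma sqn_le x : sqn f x <= functional_norm f * rnorm x ^+ 2.
Proof.
apply: le_trans (Re_le_cabs _) _; rewrite -rnorm_starM; exact: functional_norm_ub.
Qed.

(** With a unit this would be Cauchy-Schwarz against 1; a contraction u with u a close to a takes
    the place of 1. *)
Lemma functional_CS a : cabs (f a) <= Num.sqrt (functional_norm f) * nrm f a.
Proof.
have N0 := functional_norm_ge0 fb.
apply/ler_addgt0Pr => e e0.
have [|u [us u1 ua]] := approx_unit a (e := e / (functional_norm f + 1)).
  by rewrite divr_gt0// ltr_wpDl.
have -> : f a = f (cmul (cstar u) a) + f (a - cmul u a).
  by rewrite us -functionalD// addrC subrK.
apply: le_trans (cabsD _ _) _; apply: lerD.
  apply: le_trans (form_le _ _) _; rewrite ler_wpM2r ?nrm_ge0//.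
  apply: ler_wsqrtr; apply: le_trans (sqn_le u) _.
  by rewrite ler_piMr// expr_le1 ?rnorm_ge0.
apply: le_trans (functional_norm_ub fs fb _) _.
move: ua; rewrite ler_pdivlMr ?ltr_wpDl//; have := rnorm_ge0 (a - cmul u a); nra.
Qed.

Lemma functional_star a : f (cstar a) = conjc (f a).
Proof.
have N0 := functional_norm_ge0 fb.
apply/eqP; rewrite -subr_eq0; apply/eqP/cabs_eq0/le_anti; rewrite cabs_ge0 andbT.
apply/ler_addgt0Pr => e e0; rewrite add0r.
have [|u [us u1 ua]] := approx_unit a (e := e / (2 * functional_norm f + 1)).
  by rewrite divr_gt0// ltr_wpDl// mulr_ge0.
have fua : f (cmul (cstar a) u) = conjc (f (cmul u a))
  by rewrite form_conj us.
have -> : f (cstar a) - conjc (f a) =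
    f (cstar (a - cmul u a)) - conjc (f (a - cmul u a)).
  rewrite cstarB cstarM us !functionalB// fua rmorphB/=.
  by rewrite opprB addrA subrK.
apply: le_trans (cabsD _ _) _; rewrite cabsN cabs_conj.
have := functional_norm_ub fs fb (a - cmul u a).
have := functional_norm_ub fs fb (cstar (a - cmul u a)); rewrite rnorm_star.
move: ua; rewrite ler_pdivlMr ?ltr_wpDl ?mulr_ge0//.
have := rnorm_ge0 (a - cmul u a); nra.
Qed.

End PositiveForm.

Section TraceForm.
Variables (R : realType) (A : cstarAlgType R) (f : A -> R[i]).
Hypothesis f_trace : is_trace f.
Implicit Types x y z : A.

Let fs : scalar f. Proof. by case: f_trace. Qed.
Let fb : bounded_functional f. Proof. by case: f_trace. Qed.
Let fp : positive_functional f. Proof. by case: f_trace. Qed.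
Let ft a b : f (cmul a b) = f (cmul b a). Proof. by case: f_trace. Qed.

Lemma sqn_star x : sqn f (cstar x) = sqn f x.
Proof. by rewrite /sqn cstarK ft. Qed.

Lemma nrm_star x : nrm f (cstar x) = nrm f x.
Proof. by rewrite /nrm sqn_star. Qed.

Lemma nrmMr_le b x : nrm f (cmul x b) <= nrm f x * rnorm b.
Proof. by rewrite -nrm_star cstarM mulrC -(nrm_star x) -(rnorm_star b) nrmM_le. Qed.

Lemma trace_le x y : cabs (f (cmul x y)) <= nrm f x * nrm f y.
Proof. by rewrite -{1}(cstarK x) -(nrm_star x) form_le. Qed.

Lemma trace_sq_le x : cabs (f x) ^+ 2 <= functional_norm f * sqn f x.
Proof.
have N0 := functional_norm_ge0 fb.
rewrite -(sqr_nrm fp) -[X in X * _](sqr_sqrtr N0) -exprMn.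
by rewrite ler_sqr ?nnegrE ?mulr_ge0 ?sqrtr_ge0 ?nrm_ge0 ?cabs_ge0// functional_CS.
Qed.

(** An element w that nearly attains the norm M and is nearly fixed by u forces u to carry nearly
    all the mass. With t = e + M d, one has M - t <= |f(u w)|, while Cauchy-Schwarz bounds |f(u
    w)|^2 by M times [sqn f u]; finally (M - t)^2 >= M (M - 2 t). *)
Lemma mass_approx w u (e d : R) : rnorm w <= 1 -> cstar u = u -> rnorm u <= 1 ->
  0 <= e -> 0 <= d -> functional_norm f - e <= cabs (f w) ->
  sqn f (w - cmul u w) <= functional_norm f * d ^+ 2 ->
  functional_norm f - 2 * (e + functional_norm f * d) <= sqn f u.
Proof.
set M := functional_norm f => w1 us u1 e0 d0 fw dw.
have M0 : 0 <= M := functional_norm_ge0 fb.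
have S0 := sqn_ge0 fp u; have X0 := cabs_ge0 (f (cmul u w)).
have D : cabs (f (w - cmul u w)) <= M * d.
  rewrite -ler_sqr ?nnegrE ?mulr_ge0 ?cabs_ge0//.
  apply: le_trans (trace_sq_le _) _; rewrite -/M exprMn expr2 -mulrA ler_wpM2l//.
have X : M - (e + M * d) <= cabs (f (cmul u w)).
  have : f w = f (w - cmul u w) + f (cmul u w) by rewrite -functionalD// subrK.
  move=> fwE; have := cabsD (f (w - cmul u w)) (f (cmul u w)); rewrite -fwE; lra.
have Xq : cabs (f (cmul u w)) ^+ 2 <= sqn f u * M.
  rewrite -{1}us; apply: le_trans (form_CS fs fp _ _) _; rewrite ler_wpM2l//.
  apply: le_trans (sqn_le fs fb _) _; rewrite ler_piMr//.
  by rewrite expr_le1 ?rnorm_ge0.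
have Md : 0 <= M * d by rewrite mulr_ge0.
set t := e + M * d in X *; have t0 : 0 <= t by rewrite addr_ge0.
case: (leP (M - t) 0) => Mt; first lra.
have Mp : 0 < M by lra.
rewrite -(ler_pM2r Mp); nra.
Qed.

End TraceForm.

Section TraceOps.
Variables (R : realType) (A : cstarAlgType R).
Implicit Types (f g : A -> R[i]) (u w : A).

Lemma is_traceD f g : is_trace f -> is_trace g -> is_trace (fun a => f a + g a).
Proof.
move=> [fs /functional_boundedP[M fM] fp ft] [gs /functional_boundedP[N gN] gp gt].
split=> [k a b||a|a b]; last by rewrite ft gt.
- by rewrite !functionalD// !functionalZ// mulrDr addrACA.
- apply/functional_boundedP; exists (M + N) => a.
  by apply: le_trans (cabsD _ _) _; rewrite mulrDl lerD.
- by rewrite addr_ge0.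
Qed.

Lemma is_traceZ f (c : R) : 0 <= c -> is_trace f -> is_trace (fun a => c%:C * f a).
Proof.
move=> c0 [fs /functional_boundedP[M fM] fp ft].
split=> [k a b||a|a b]; last by rewrite ft.
- by rewrite functionalD// functionalZ// mulrDr mulrCA.
- apply/functional_boundedP; exists (c * M) => a.
  by rewrite cabsM cabsR ger0_norm// -mulrA ler_wpM2l.
- by rewrite mulr_ge0// ler0c.
Qed.

Lemma is_traceB f g : is_trace f -> is_trace g ->
  (forall x, sqn g x <= sqn f x) -> is_trace (fun a => f a - g a).
Proof.
move=> [fs /functional_boundedP[M fM] fp ft] [gs /functional_boundedP[N gN] gp gt] gf.
split=> [k a b||a|a b]; last by rewrite ft gt.
- by rewrite !functionalD// !functionalZ// mulrBr opprD addrACA.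
- apply/functional_boundedP; exists (M + N) => a.
  by apply: le_trans (cabsD _ _) _; rewrite mulrDl cabsN lerD.
- by rewrite !sqnE// -rmorphB/= ler0c subr_ge0.
Qed.

Lemma functional_normZ f (c : R) : 0 <= c -> bounded_functional f ->
  functional_norm (fun a => c%:C * f a) = c * functional_norm f.
Proof.
move=> c0 fb; have fc a : cabs (c%:C * f a) = c * cabs (f a).
  by rewrite cabsM cabsR ger0_norm.
apply/le_anti/andP; split.
  apply: functional_norm_le => a a1.
  by rewrite fc ler_wpM2l//; exact: functional_norm_ub1.
apply/ler_addgt0Pr => e e0.
have [|a a1 fa] := functional_norm_approx (e := e / (c + 1)) _ fb.
  by rewrite divr_gt0// ltr_wpDl.
have cb : bounded_functional (fun a => c%:C * f a).
  have [M fM] := (functional_boundedP f).1 fb.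
  by apply/functional_boundedP; exists (c * M) => b; rewrite fc -mulrA ler_wpM2l.
have := functional_norm_ub1 cb a1; rewrite fc.
have : c * (e / (c + 1)) <= e.
  by rewrite mulrCA ler_piMr ?(ltW e0)// ler_pdivrMr ?ltr_wpDl// mul1r lerDl.
nra.
Qed.

Let sandwich u w := w - cmul w u - cmul u (w - cmul w u).

Let sandwichD u w z : sandwich u (w + z) = sandwich u w + sandwich u z.
Proof.
rewrite /sandwich cmulDl opprD [w + z + _]addrACA cmulDr opprD.
by rewrite [LHS]addrACA.
Qed.

Let sandwichE u w : cstar u = u ->
  cmul (w - cmul u w) (cstar (w - cmul u w)) = sandwich u (cmul w (cstar w)).
Proof.
move=> us; rewrite /sandwich cstarB cstarM us cmulBl -[cmul (cmul u w) _]cmulA.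
by rewrite cmulBr [cmul w (cmul _ u)]cmulA.
Qed.

(* With [s = w w^* + z z^*], an approximate unit for [s] nearly fixes both [w]
   and [z] in the seminorm of every trace. *)
Lemma functional_normD f g : is_trace f -> is_trace g ->
  functional_norm (fun a => f a + g a) = functional_norm f + functional_norm g.
Proof.
move=> trf trg; have [fs fb fp ft] := trf; have [gs gb gp gt] := trg.
have [_ fgb _ _] := is_traceD trf trg.
have M0 := functional_norm_ge0 fb; have N0 := functional_norm_ge0 gb.
apply/le_anti/andP; split.
  apply: functional_norm_le => a a1; apply: le_trans (cabsD _ _) _.
  by apply: lerD; exact: functional_norm_ub1.
set M := functional_norm f in M0 *; set N := functional_norm g in N0 *.
apply/ler_addgt0Pr => e e0; have e8 : 0 < e / 8 by rewrite divr_gt0.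
have [w w1 fw] := functional_norm_approx e8 fb.
have [z z1 gz] := functional_norm_approx e8 gb.
pose s := cmul w (cstar w) + cmul z (cstar z).
have ss : cstar s = s by rewrite /s cstarD !cstarM !cstarK.
pose d := e / (4 * (M + N + 1)).
have d0 : 0 < d by rewrite divr_gt0// mulr_gt0// ltr_wpDl// addr_ge0.
have [|u [us u1 ud]] := approx_unit_sandwich (e := d ^+ 2) ss; first by rewrite exprn_gt0.
have su : s - cmul s u - cmul u (s - cmul s u) =
    cmul (cstar (cstar (w - cmul u w))) (cstar (w - cmul u w)) +
    cmul (cstar (cstar (z - cmul u z))) (cstar (z - cmul u z)).
  by rewrite !cstarK !sandwichE// -sandwichD.
have bound h : is_trace h ->
    sqn h (w - cmul u w) + sqn h (z - cmul u z) <= functional_norm h * d ^+ 2.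
  move=> trh; have [hs hb hp ht] := trh.
  rewrite -(sqn_star trh (w - _)) -(sqn_star trh (z - _)) /sqn -cReD -functionalD// -su.
  apply: le_trans (Re_le_cabs _) _; apply: le_trans (functional_norm_ub hs hb _) _.
  by rewrite ler_wpM2l//; exact: functional_norm_ge0.
have fu : M - 2 * (e / 8 + M * d) <= sqn f u.
  apply: (mass_approx trf w1); rewrite ?(ltW e8) ?(ltW d0) ?(ltW fw)//.
  by apply: le_trans (bound _ trf); rewrite lerDl sqn_ge0.
have gu : N - 2 * (e / 8 + N * d) <= sqn g u.
  apply: (mass_approx trg z1); rewrite ?(ltW e8) ?(ltW d0) ?(ltW gz)//.
  by apply: le_trans (bound _ trg); rewrite lerDr sqn_ge0.
have : sqn f u + sqn g u <= functional_norm (fun a => f a + g a).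
  rewrite /sqn -cReD; apply: le_trans (Re_le_cabs _) _.
  apply: (functional_norm_ub1 fgb); rewrite rnorm_starM.
  by rewrite expr_le1 ?rnorm_ge0.
have : 4 * (M + N + 1) * d = e.
  by rewrite /d mulrC divfK// mulf_neq0// gt_eqF// ltr_wpDl// addr_ge0.
nra.
Qed.

Lemma functional_norm_eq0 f : scalar f -> bounded_functional f ->
  functional_norm f = 0 -> forall a, f a = 0.
Proof.
move=> fs fb f0 a; apply: cabs_eq0; apply/le_anti; rewrite cabs_ge0 andbT.
by have := functional_norm_ub fs fb a; rewrite f0 mul0r.
Qed.

(** With m the norm of g, f is the convex combination of g / m and (f - g) / (1 - m). Additivity of
    the norm on traces makes the second one a state; m = 0 and m = 1 are treated apart. *)
Lemma extremal_dominated f g : extremal_tracial_state f -> is_trace g ->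
  (forall x, sqn g x <= sqn f x) ->
  forall a, g a = (functional_norm g)%:C * f a.
Proof.
move=> [[trf f1] ext] trg gf; have [gs gb _ _] := trg.
have trh := is_traceB trf trg gf; have [hs hb _ _] := trh.
set m := functional_norm g; have m0 : 0 <= m := functional_norm_ge0 gb.
have hm : functional_norm (fun a => f a - g a) = 1 - m.
  have := functional_normD trg trh; rewrite -f1.
  have -> : (fun a => g a + (f a - g a)) = f by apply/funext => a; rewrite addrC subrK.
  by rewrite -/m => ->; rewrite [m + _]addrC addrK.
have m1 : 0 <= 1 - m by rewrite -hm functional_norm_ge0.
have [mz|mn0] := eqVneq m 0.
  by move=> a; rewrite mz mul0r functional_norm_eq0.
have [mo|mn1] := eqVneq (1 - m) 0.
  move=> a; have := functional_norm_eq0 hs hb (etrans hm mo) a.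
  have -> : m = 1 by move/eqP: mo; rewrite subr_eq0 => /eqP.
  by rewrite mul1r => /eqP; rewrite subr_eq0 => /eqP.
have {}m0 : 0 < m by rewrite lt_def mn0.
have {}m1 : 0 < 1 - m by rewrite lt_def mn1.
have [||||gE _] := ext (fun a => m^-1%:C * g a)
    (fun a => (1 - m)^-1%:C * (f a - g a)) m.
- split; first by apply: is_traceZ; rewrite // invr_ge0 ltW.
  by rewrite functional_normZ ?invr_ge0 ?(ltW m0)// mulVf.
- split; first by apply: is_traceZ; rewrite // invr_ge0 ltW.
  by rewrite functional_normZ ?invr_ge0 ?(ltW m1)// hm mulVf.
- by rewrite m0; lra.
- by move=> a; rewrite !mulrA -!rmorphM/= !mulfV// !mul1r addrC subrK.
by move=> a; rewrite -[in RHS]gE mulrA -rmorphM/= mulfV// mul1r.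
Qed.

End TraceOps.

(** * Limits along ultrafilters *)

Section UltraLimit.
Variables (R : realType) (T : Type) (F : set_system T).
Context {FU : UltraFilter F}.
Implicit Types (x y : T -> R[i]) (l m : R[i]).

Definition uconv x l := forall e : R, 0 < e -> F [set k | cabs (x k - l) < e].

Definition ulim x : R[i] := xget 0 [set l | uconv x l].

Lemma uconv_near x l (y : T -> R) :
  (forall e : R, 0 < e -> F [set k | y k < e]) ->
  F [set k | cabs (x k - l) <= y k] -> uconv x l.
Proof.
move=> y0 xy e e0; apply: filterS2 xy (y0 e e0) => k /=; exact: le_lt_trans.
Qed.

Lemma uconv_unique x l m : uconv x l -> uconv x m -> l = m.
Proof.
move=> xl xm; apply/eqP; rewrite -subr_eq0; apply/eqP/cabs_eq0/le_anti.
rewrite cabs_ge0 andbT; apply/ler_addgt0Pr => e e0; rewrite add0r.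
have e2 : 0 < e / 2 by rewrite divr_gt0.
have [k /= [kl km]] := filter_ex (filterI (xl _ e2) (xm _ e2)).
have -> : l - m = (x k - m) - (x k - l) by ring.
by apply: le_trans (cabsD _ _) _; rewrite cabsN; lra.
Qed.

Lemma uconvD x y l m : uconv x l -> uconv y m -> uconv (fun k => x k + y k) (l + m).
Proof.
move=> xl ym e e0; have e2 : 0 < e / 2 by rewrite divr_gt0.
apply: filterS2 (xl _ e2) (ym _ e2) => k /= kl km.
have -> : x k + y k - (l + m) = (x k - l) + (y k - m) by ring.
by apply: le_lt_trans (cabsD _ _) _; lra.
Qed.

Lemma uconvZ c x l : uconv x l -> uconv (fun k => c * x k) (c * l).
Proof.
move=> xl e e0; have c0 := cabs_ge0 c.
have ec : 0 < e / (cabs c + 1) by rewrite divr_gt0// ltr_wpDl.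
apply: filterS (xl _ ec) => k /=; rewrite ltr_pdivlMr ?ltr_wpDl// -mulrBr cabsM.
by have := cabs_ge0 (x k - l); nra.
Qed.

Lemma uconv_cabs_le x l (M : R) : uconv x l -> (forall k, cabs (x k) <= M) -> cabs l <= M.
Proof.
move=> xl xM; apply/ler_addgt0Pr => e e0; have [k /= kl] := filter_ex (xl _ e0).
have -> : l = x k - (x k - l) by ring.
by apply: le_trans (cabsD _ _) _; rewrite cabsN; have := xM k; lra.
Qed.

Lemma Re_dist (z w : R[i]) : `|complex.Re z - complex.Re w| <= cabs (z - w).
Proof.
rewrite ler_norml -cReB Re_le_cabs andbT lerNl -cReN.
by apply: le_trans (Re_le_cabs _) _; rewrite cabsN.
Qed.

Lemma uconv_Re_ge x l (a : R) (y : T -> R) :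
  (forall e : R, 0 < e -> F [set k | y k < e]) -> uconv x l ->
  (forall k, a - y k <= complex.Re (x k)) -> a <= complex.Re l.
Proof.
move=> y0 xl xa; apply/ler_addgt0Pr => e e0; have e2 : 0 < e / 2 by rewrite divr_gt0.
have [k /= [kl ky]] := filter_ex (filterI (xl _ e2) (y0 _ e2)).
by have := xa k; have := Re_dist (x k) l; rewrite ler_norml => /andP[]; lra.
Qed.

Lemma uconv_Re_le x l (a : R) (y : T -> R) :
  (forall e : R, 0 < e -> F [set k | y k < e]) -> uconv x l ->
  (forall k, complex.Re (x k) <= a + y k) -> complex.Re l <= a.
Proof.
move=> y0 xl xa; apply/ler_addgt0Pr => e e0; have e2 : 0 < e / 2 by rewrite divr_gt0.
have [k /= [kl ky]] := filter_ex (filterI (xl _ e2) (y0 _ e2)).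
by have := xa k; have := Re_dist (x k) l; rewrite ler_norml => /andP[]; lra.
Qed.

Lemma uconv_conj x l : uconv x l -> uconv (fun k => conjc (x k)) (conjc l).
Proof.
by move=> xl e e0; apply: filterS (xl _ e0) => k /=; rewrite -rmorphB cabs_conj.
Qed.

Lemma uconv_eq x y l : (forall k, x k = y k) -> uconv x l -> uconv y l.
Proof. by move=> xy xl e e0; apply: filterS (xl _ e0) => k /=; rewrite xy. Qed.

Lemma uconv_ge0 x l : uconv x l -> (forall k, 0 <= x k) -> 0 <= l.
Proof.
move=> xl x0; have xr k : conjc (x k) = x k.
  by have := x0 k; rewrite lecE => /andP[/eqP/= + _]; case: (x k) => a b /= ->; rewrite oppr0.
have lr : conjc l = l := uconv_unique (uconv_eq xr (uconv_conj xl)) xl.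
rewrite lecE; apply/andP; split.
  by move: lr; case: l {xl} => a b /= [] bN; apply/eqP; lra.
apply: (uconv_Re_ge (y := fun=> 0) _ xl) => [e e0|k]; first exact: filterE.
by have := x0 k; rewrite lecE subr0 => /andP[].
Qed.

(** The limit is the supremum of the levels r with r <= u k for almost all k. Any level above it is
    almost everywhere not reached, because F is an ultrafilter. *)
Let real_ulim (u : T -> R) (M : R) : (forall k, `|u k| <= M) ->
  exists l : R, forall e : R, 0 < e -> F [set k | `|u k - l| < e].
Proof.
move=> uM; pose E := [set r | F [set k | r <= u k]].
have EM : ubound E M.
  move=> r Er; have [k /= rk] := filter_ex (Er : F _).
  by apply: le_trans rk _; apply: le_trans (ler_norm _) (uM k).
have E0 : E !=set0.
  exists (- M); apply: filterE => k /=.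
  by have := uM k; rewrite ler_norml => /andP[].
exists (sup E) => e e0.
have [r Er rE] : exists2 r, E r & sup E - e < r.
  by apply: sup_adherent => //; split=> //; exists M.
have : ~ E (sup E + e / 2).
  by move=> Ee; have := ub_le_sup (ex_intro _ M EM : has_ubound E) Ee; lra.
case: (in_ultra_setVsetC [set k | sup E + e / 2 <= u k] FU) => // Fc _.
apply: filterS2 Er Fc => k /= rk /negP; rewrite -ltNge => kl.
by rewrite ltr_norml; lra.
Qed.

Lemma ulimP x (M : R) : (forall k, cabs (x k) <= M) -> uconv x (ulim x).
Proof.
move=> xM; suff [l xl] : exists l, uconv x l by exact: (xgetPex 0 (ex_intro [set l | uconv x l] l xl)).
have [|a xa] := @real_ulim (fun k => complex.Re (x k)) M.
  move=> k; apply: le_trans (xM k); have := Re_dist (x k) 0; by rewrite !subr0.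
have [|b xb] := @real_ulim (fun k => complex.Im (x k)) M.
  move=> k; apply: le_trans (xM k).
  rewrite -ler_sqr ?nnegrE ?normr_ge0 ?cabs_ge0// cabsq real_normK ?num_real//.
  by rewrite lerDr sqr_ge0.
exists (a +i* b) => e e0; have e2 : 0 < e / 2 by rewrite divr_gt0.
apply: filterS2 (xa _ e2) (xb _ e2) => k /= ka kb.
have -> : x k - a +i* b = (complex.Re (x k) - a)%:C + 'i%C * (complex.Im (x k) - b)%:C.
  by case: (x k) => c d /=; apply/eqP; rewrite eq_complex/=; apply/andP; split; apply/eqP; ring.
apply: le_lt_trans (cabsD _ _) _; rewrite cabsM cabs_i mul1r !cabsR; lra.
Qed.

Lemma ulim_eq x l : uconv x l -> ulim x = l.
Proof.
move=> xl; apply: (uconv_unique _ xl).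
exact: (xgetPex 0 (ex_intro [set l | uconv x l] l xl)).
Qed.

End UltraLimit.

Section Nonprincipal.
Variable U : ultra_on nat.
Hypothesis U_np : nonprincipal U.

(** An ultrafilter containing a singleton is principal, so points can be removed from a tail one at
    a time. *)
Lemma nonprincipal_ge n : ultra_system U [set k | (n <= k)%N].
Proof.
elim: n => [|n IH]; first by apply: filterE.
have nU : ~ ultra_system U [set n].
  move=> Un; suff : ultra_system U = principal_filter n by exact: U_np.
  apply/funext => B; apply/propext; split=> [UB|/principal_filterP Bn].
    have [k /= [kn Bk]] := filter_ex (filterI Un UB).
    by apply/principal_filterP; rewrite -kn.
  by apply: filterS Un => k ->.
case: (in_ultra_setVsetC [set n] (ultra_onP U)) => // Uc.
apply: filterS2 IH Uc => k /= nk kn; rewrite ltn_neqAle nk andbT.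
by apply/eqP => nk'; apply: kn.
Qed.

Lemma nonprincipal_inv (R : realType) (e : R) : 0 < e ->
  ultra_system U [set k | k.+1%:R^-1 < e].
Proof.
move=> e0; apply: filterS (nonprincipal_ge (Num.bound e^-1)) => k /= ek.
rewrite invf_plt ?posrE//; apply: lt_le_trans (archi_boundP _) _.
  by rewrite invr_ge0 ltW.
by rewrite ler_nat ltnW.
Qed.

End Nonprincipal.

(** * Mutual singularity of extremal traces *)

Section NearUnit.
Variables (R : realType) (A : cstarAlgType R).
Implicit Types (f g : A -> R[i]) (w y z : A).

(** If f had density h for g, the minimized quantity would be the squared g-distance from y to h, up
    to a constant. Perturbing y by multiples of [cstar z] turns near-minimality into an approximate
    Euler equation through [quad_discr]. *)
Lemma near_minimum f g y (d : R) : is_trace f -> is_trace g ->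
  (forall y', sqn g y - 2 * complex.Re (f y) <=
              sqn g y' - 2 * complex.Re (f y') + d ^+ 2) -> 0 <= d ->
  forall z, cabs (f z - g (cmul z y)) <= d * nrm g z.
Proof.
move=> trf trg ymin d0 z; have [fs fb fp ft] := trf; have [gs gb gp gt] := trg.
rewrite -ler_sqr ?nnegrE ?mulr_ge0 ?nrm_ge0 ?cabs_ge0// exprMn sqr_nrm// -cabsN opprB.
apply: quad_discr; first exact: sqn_ge0.
move=> c; have := ymin (conjc c *: cstar z + y).
rewrite sqnD// sqnZ// sqn_star// cabs_conj cstarZc conjcK cstarK -cscaleAl.
rewrite functionalZ// functionalD// functionalZ// functional_star// -rmorphM/=.
by rewrite !cReD cRe_conj mulrBr cReB; lra.
Qed.

(** Cauchy-Schwarz bounds the gap below by |f(y)|^2 - 2 |f(y)|. *)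
Lemma state_gap_ge f g y : is_trace f -> functional_norm f = 1 ->
  sqn f y <= sqn g y -> -1 <= sqn g y - 2 * complex.Re (f y).
Proof.
move=> trf f1 fg; have := trace_sq_le trf y; rewrite f1 mul1r.
by have := Re_le_cabs (f y); have := sqr_ge0 (cabs (f y) - 1); nra.
Qed.

(* [d] bounds the distance from [y] to [1] in the seminorm [nrm f]. *)
Definition near_unit f (y : A) (d : R) :=
  forall z, cabs (f z - f (cmul z y)) <= d * nrm f z.

(** In the unitization the left side plus 1 is the squared seminorm of 1 - y. As -1 is a lower bound
    for the gap, y is a near-minimum with g = f. *)
Lemma near_unit_gap f y (d : R) : is_trace f -> functional_norm f = 1 -> 0 <= d ->
  sqn f y - 2 * complex.Re (f y) <= -1 + d ^+ 2 -> near_unit f y d.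
Proof.
move=> trf f1 d0 yd; apply: near_minimum => // y'.
by have := state_gap_ge trf f1 (lexx (sqn f y')); lra.
Qed.

Lemma near_unit_contraction f w (d : R) : is_trace f -> functional_norm f = 1 ->
  0 <= d -> rnorm w <= 1 -> 1 - d ^+ 2 / 2 <= complex.Re (f w) -> near_unit f w d.
Proof.
move=> trf f1 d0 w1 fw; have [fs fb fp ft] := trf.
apply: near_unit_gap => //; have := sqn_le fs fb w; rewrite f1 mul1r.
have : rnorm w ^+ 2 <= 1 by rewrite expr_le1 ?rnorm_ge0.
lra.
Qed.

Lemma functional_norm_approx_Re f (d : R) : scalar f -> bounded_functional f -> 0 < d ->
  exists2 w, rnorm w <= 1 & functional_norm f - d <= complex.Re (f w).
Proof.
move=> fs fb d0; have [w w1 fw] := functional_norm_approx d0 fb.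
have [f0|fn] := eqVneq (f w) 0.
  by exists 0; rewrite ?rnorm0// functional0//; move: fw; rewrite f0 cabs0 /=; lra.
have c0 : cabs (f w) != 0 by apply: contra_neq fn; exact: cabs_eq0.
have cp : 0 < cabs (f w) by rewrite lt_def c0 cabs_ge0.
exists (((cabs (f w))^-1)%:C *: (conjc (f w) *: w)).
  by rewrite rnormZR rnormZc cabs_conj gtr0_norm ?invr_gt0// mulKf.
rewrite !functionalZ// conjcM_cabs cReMr cReR expr2 mulKf//; exact: ltW.
Qed.

End NearUnit.

Section Disjoint.
Variables (R : realType) (A : cstarAlgType R) (U : ultra_on nat).
Hypothesis U_np : nonprincipal U.
Variables s s' : A -> R[i].
Hypotheses (ext_s : extremal_tracial_state s) (ext_s' : extremal_tracial_state s').
Hypothesis ss' : s <> s'.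
Implicit Types a x y z : A.

Let trs : is_trace s. Proof. by case: ext_s => -[]. Qed.
Let trs' : is_trace s'. Proof. by case: ext_s' => -[]. Qed.
Let s1 : functional_norm s = 1. Proof. by case: ext_s => -[]. Qed.
Let s1' : functional_norm s' = 1. Proof. by case: ext_s' => -[]. Qed.
Let lin_s : scalar s. Proof. by case: trs. Qed.
Let lin_s' : scalar s'. Proof. by case: trs'. Qed.
Let bd_s : bounded_functional s. Proof. by case: trs. Qed.
Let bd_s' : bounded_functional s'. Proof. by case: trs'. Qed.
Let pos_s : positive_functional s. Proof. by case: trs. Qed.
Let pos_s' : positive_functional s'. Proof. by case: trs'. Qed.
Let tr_s a b : s (cmul a b) = s (cmul b a). Proof. by case: trs. Qed.
Let tr_s' a b : s' (cmul a b) = s' (cmul b a). Proof. by case: trs'. Qed.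

Let t a := s a + s' a.
Let trt : is_trace t. Proof. exact: is_traceD. Qed.
Let lin_t : scalar t. Proof. by case: trt. Qed.
Let bd_t : bounded_functional t. Proof. by case: trt. Qed.
Let pos_t : positive_functional t. Proof. by case: trt. Qed.
Let tr_t a b : t (cmul a b) = t (cmul b a). Proof. by case: trt. Qed.

Let sqn_t x : sqn t x = sqn s x + sqn s' x.
Proof. by rewrite /sqn cReD. Qed.

Let nrm_s x : nrm s x <= nrm t x.
Proof. by apply: ler_wsqrtr; rewrite sqn_t lerDl sqn_ge0. Qed.

Let nrm_s' x : nrm s' x <= nrm t x.
Proof. by apply: ler_wsqrtr; rewrite sqn_t lerDr sqn_ge0. Qed.

Let gap y := sqn t y - 2 * complex.Re (s y).

Let gap_ge y : -1 <= gap y.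
Proof. by apply: state_gap_ge => //; rewrite sqn_t lerDl sqn_ge0. Qed.

(** The self-adjoint part has the same Re s and no larger seminorm, so a minimizing sequence may be
    taken self-adjoint. *)
Let gap_sym y : gap ((2^-1)%:C *: (y + cstar y)) <= gap y.
Proof.
rewrite /gap functionalZ// functionalD// functional_star// cReMr cReD cRe_conj.
rewrite -!(sqr_nrm pos_t) nrmZ// cabsR ger0_norm ?invr_ge0//.
have := nrmD lin_t pos_t y (cstar y); rewrite (nrm_star trt).
have := nrm_ge0 t (y + cstar y); have := nrm_ge0 t y; nra.
Qed.

Let d k : R := k.+1%:R^-1.
Let d_gt0 k : 0 < d k. Proof. by rewrite invr_gt0. Qed.
Let d_le1 k : d k <= 1. Proof. by rewrite invf_le1// ler1n. Qed.

Let ex_min k : {y | cstar y = y & forall y', gap y <= gap y' + d k ^+ 2}.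
Proof.
apply: cid2.
have d2 : 0 < d k ^+ 2 by rewrite exprn_gt0.
have ginf : has_inf (range gap).
  by split; [exists (gap 0); exists 0 | exists (-1) => _ [y _ <-]; exact: gap_ge].
have [_ [y _ <-] yd] := inf_adherent d2 ginf.
exists ((2^-1)%:C *: (y + cstar y)).
  by rewrite cstarZc conjc_real cstarD cstarK addrC.
move=> y'; apply: le_trans (gap_sym y) _; apply: le_trans (ltW yd) _.
by rewrite lerD2r; apply: ge_inf; [exact: ginf.2 | exists y'].
Qed.

(* An approximate Radon-Nikodym derivative of [s] with respect to [t]. *)
Let y k := s2val (ex_min k).
Let ys k : cstar (y k) = y k. Proof. exact: (s2valP (ex_min k)). Qed.
Let ymin k y' : gap (y k) <= gap y' + d k ^+ 2.
Proof. exact: (s2valP' (ex_min k)). Qed.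

Let deriv k z : cabs (s z - t (cmul z (y k))) <= d k * nrm t z.
Proof. by apply: near_minimum => //; [exact: ymin | exact: ltW]. Qed.

(** Comparison with y' = 0 gives n^2 <= 2 n + 1 for the seminorm n of y k. *)
Let y_bound k : nrm t (y k) <= 3.
Proof.
have := ymin k 0; rewrite /gap functional0//= -(sqr_nrm pos_t).
have -> : sqn t 0 = 0 by rewrite /sqn cmulr0 functional0.
have : d k ^+ 2 <= 1 by rewrite expr_le1// ltW.
have := Re_le_cabs (s (y k)); have := functional_CS lin_s pos_s bd_s (y k).
rewrite s1 sqrtr1 mul1r; have := nrm_s (y k); have := nrm_ge0 t (y k); nra.
Qed.

(** The density of one trace with respect to another is central: with c the commutator, t applied to
    (cstar c) c is close to s(a (cstar c)) - s((cstar c) a) = 0. *)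
Let y_central k a : nrm t (cmul (y k) a - cmul a (y k)) <= 2 * d k * rnorm a.
Proof.
set c := cmul _ _ - _; set n := nrm t c.
have n0 : 0 <= n := nrm_ge0 _ _.
have : n ^+ 2 <= d k * (2 * (rnorm a * n)).
  rewrite (sqr_nrm pos_t); apply: le_trans (Re_le_cabs _) _.
  rewrite {2}/c cmulBr functionalB// !cmulA [t (cmul _ a)]tr_t cmulA.
  have -> : t (cmul (cmul a (cstar c)) (y k)) - t (cmul (cmul (cstar c) a) (y k)) =
      (s (cmul (cstar c) a) - t (cmul (cmul (cstar c) a) (y k)))
      - (s (cmul a (cstar c)) - t (cmul (cmul a (cstar c)) (y k))).
    by rewrite [s (cmul a _)]tr_s; ring.
  apply: le_trans (cabsD _ _) _; rewrite cabsN.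
  have := deriv k (cmul (cstar c) a); have := deriv k (cmul a (cstar c)).
  have := nrmM_le lin_t pos_t bd_t a (cstar c); have := nrmMr_le trt a (cstar c).
  rewrite (nrm_star trt) -/n; have := d_gt0 k; nra.
move=> nn; have [->|n1] := eqVneq n 0.
  by rewrite !mulr_ge0 ?rnorm_ge0 ?(ltW (d_gt0 k)).
by rewrite -(@ler_pM2r _ n) ?lt_def ?n1//; move: nn; rewrite expr2; lra.
Qed.

Let th z := ulim (ultra_system U) (fun k => s' (cmul z (y k))).

Let th_bound z k : cabs (s' (cmul z (y k))) <= 3 * nrm s' z.
Proof.
apply: le_trans (trace_le trs' _ _) _; rewrite mulrC ler_wpM2r ?nrm_ge0//.
exact: le_trans (nrm_s' _) (y_bound k).
Qed.

Let th_conv z : uconv (ultra_system U) (fun k => s' (cmul z (y k))) (th z).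
Proof. exact: ulimP (th_bound z). Qed.

Let d_conv (C e : R) : 0 <= C -> 0 < e -> ultra_system U [set k | C * d k < e].
Proof.
move=> C0 e0; have eC : 0 < e / (C + 1) by rewrite divr_gt0// ltr_wpDl.
apply: filterS (nonprincipal_inv U_np eC) => k /=.
by rewrite -/(d k) ltr_pdivlMr ?ltr_wpDl//; have := d_gt0 k; nra.
Qed.

(** This is 0 <= h (1 - h) <= h, 1 - h up to errors. With b = a (y k), x is close to
    [sqn s a - sqn t b]. The lower bound comes from [sqn s (a - b)] and [sqn s' b] being
    nonnegative, the first upper bound from [sqn t b], the second from [sqn t (a - b)]. *)
Let th_square a k :
  let C := 3 * (nrm t (cmul (cstar a) a) + 3 * rnorm (cmul (cstar a) a)) in
  let x := complex.Re (s' (cmul (cmul (cstar a) a) (y k))) in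
  [/\ - (C * d k) <= x, x <= sqn s a + C * d k & x <= sqn s' a + C * d k].
Proof.
move=> C x; set p := cmul (cstar a) a in C x *; set b := cmul a (y k).
have ab f : f (cmul (cstar a) b) = f (cmul p (y k)) :> R[i] by rewrite /b /p cmulA.
have h1 := le_trans (Re_dist _ _) (deriv k p).
have h2 := le_trans (Re_dist _ _) (deriv k (cmul (y k) p)).
have TE : complex.Re (t (cmul (cmul (y k) p) (y k))) = sqn t b.
  by rewrite /sqn /b cstarM ys /p !cmulA.
have yp : nrm t (cmul (y k) p) <= 3 * rnorm p.
  apply: le_trans (nrmMr_le trt _ _) _; rewrite ler_wpM2r ?rnorm_ge0//; exact: y_bound.
rewrite TE tr_s in h2; rewrite -/(sqn s a) in h1.
have xE : x = complex.Re (t (cmul p (y k))) - complex.Re (s (cmul p (y k))).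
  by rewrite /x /t cReD; ring.
have q1 : 0 <= sqn s (a - b) by exact: sqn_ge0.
have q2 : 0 <= sqn t (a - b) by exact: sqn_ge0.
have q3 : 0 <= sqn s' b by exact: sqn_ge0.
have q4 : 0 <= sqn s b by exact: sqn_ge0.
rewrite sqnD// sqnN// cmulNr functionalN// cReN ab in q1.
rewrite sqnD// sqnN// cmulNr functionalN// cReN ab in q2.
have tb := sqn_t b; have ta := sqn_t a.
have yp' : d k * nrm t (cmul (y k) p) <= d k * (3 * rnorm p).
  by rewrite ler_wpM2l ?(ltW (d_gt0 k)).
have n0 : 0 <= d k * nrm t p by rewrite mulr_ge0 ?nrm_ge0 ?(ltW (d_gt0 k)).
have r0 : 0 <= d k * (3 * rnorm p) by rewrite !mulr_ge0 ?rnorm_ge0 ?(ltW (d_gt0 k)).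
have CE : C * d k = 3 * (d k * nrm t p) + 3 * (d k * (3 * rnorm p)) by rewrite /C; ring.
move: h1 h2; rewrite !ler_norml => /andP[h11 h12] /andP[h21 h22].
by rewrite CE xE; split; lra.
Qed.

Let C_ge0 a : 0 <= 3 * (nrm t (cmul (cstar a) a) + 3 * rnorm (cmul (cstar a) a)).
Proof. by rewrite mulr_ge0// addr_ge0 ?nrm_ge0// mulr_ge0// rnorm_ge0. Qed.

Let th_trace : is_trace th.
Proof.
split.
- move=> c a b; apply: ulim_eq.
  apply: uconv_eq (uconvD (uconvZ c (th_conv a)) (th_conv b)) => k.
  by rewrite cmulDl functionalD// -cscaleAl functionalZ.
- apply/functional_boundedP; exists 3 => a; apply: uconv_cabs_le (th_conv a) _ => k.
  apply: le_trans (th_bound _ _) _; rewrite ler_wpM2l//.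
  apply: nrm_le => //; first exact: rnorm_ge0.
  by have := sqn_le lin_s' bd_s' a; rewrite s1' mul1r.
- move=> a; set p := cmul (cstar a) a.
  have pr k : conjc (s' (cmul p (y k))) = s' (cmul p (y k)).
    by rewrite -functional_star// cstarM ys tr_s' /p cstarM cstarK.
  have lr : conjc (th p) = th p.
    exact: (uconv_unique (uconv_eq pr (uconv_conj (th_conv p))) (th_conv p)).
  rewrite lecE; apply/andP; split.
    by move: lr; case: (th p) => u v [] vN; apply/eqP => /=; lra.
  apply: (uconv_Re_ge _ (th_conv p)); first by move=> e; apply: d_conv; exact: (C_ge0 a).
  by move=> k; rewrite sub0r; case: (th_square a k).
- move=> a b; apply: ulim_eq.
  have dC : 0 <= nrm s' b * (2 * rnorm a) by rewrite !mulr_ge0 ?nrm_ge0 ?rnorm_ge0.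
  (* Traciality of the limit: moving y k past a costs a multiple of d k by [y_central], which
     vanishes along U. *)
  have D : uconv (ultra_system U)
      (fun k => s' (cmul b (cmul (y k) a - cmul a (y k)))) 0.
    apply: (uconv_near (fun e => @d_conv _ e dC)); apply: filterE => k /=; rewrite subr0.
    apply: le_trans (trace_le trs' _ _) _; rewrite -mulrA ler_wpM2l ?nrm_ge0//.
    by apply: le_trans (nrm_s' _) _; rewrite mulrAC y_central.
  rewrite -[th (cmul b a)]add0r; apply: uconv_eq (uconvD D (th_conv (cmul b a))) => k.
  rewrite cmulBr functionalB// !cmulA subrK.
  by rewrite [LHS]tr_s' !cmulA.
Qed.

Let th_eq0 z : th z = 0.
Proof.
have le_s x : sqn th x <= sqn s x.
  apply: (uconv_Re_le _ (th_conv _)); first by move=> e; apply: d_conv; exact: (C_ge0 x).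
  by move=> k; case: (th_square x k).
have le_s' x : sqn th x <= sqn s' x.
  apply: (uconv_Re_le _ (th_conv _)); first by move=> e; apply: d_conv; exact: (C_ge0 x).
  by move=> k; case: (th_square x k).
have e1 := extremal_dominated ext_s th_trace le_s.
have e2 := extremal_dominated ext_s' th_trace le_s'.
have [m0|mn] := eqVneq (functional_norm th) 0; first by rewrite e1 m0 mul0r.
case: ss'; apply/funext => a; have mC : (functional_norm th)%:C != 0 :> R[i].
  by apply: contra_neq mn => /complexI.
by apply: (mulfI mC); rewrite -e1 -e2.
Qed.

(** The left side plus 1 is the squared distance from y to 1 for s plus the squared distance from y
    to 0 for s'. For y = y k with k large and w nearly a unit for s, the gap is close to -s(y), then
    -s(w y), then -t(w y), as s'(w y) is small by [th_eq0], then -s(w), which is close to -1. *)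
Lemma extremal_disjoint (e : R) : 0 < e ->
  exists2 y, cstar y = y & sqn s y + sqn s' y - 2 * complex.Re (s y) <= -1 + e.
Proof.
(* The successive errors 3h, 3h, h, 2h and h^2 / 2 add up to less than 12 h. *)
move=> e0; pose h := Num.min 1 (e / 12).
have h0 : 0 < h by rewrite lt_min ltr01 divr_gt0.
have h1 : h <= 1 by rewrite ge_min lexx.
have he : 12 * h <= e by rewrite mulrC -ler_pdivlMr// ge_min lexx orbT.
have [|w w1] := functional_norm_approx_Re (d := h ^+ 2 / 2) lin_s bd_s.
  by rewrite divr_gt0// exprn_gt0.
rewrite s1 => sw; have wu := near_unit_contraction trs s1 (ltW h0) w1 sw.
have [k /= [kd kw]] : exists k, [set k | 1 * d k < h] k /\
    [set k | cabs (s' (cmul w (y k)) - th w) < h] k.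
  exact: (filter_ex (filterI (d_conv ler01 h0) (th_conv w h0))).
exists (y k) => //; rewrite -sqn_t -/(gap (y k)).
rewrite th_eq0 subr0 in kw; rewrite mul1r in kd.
have := le_trans (Re_dist _ _) (deriv k (y k)).
have -> : complex.Re (t (cmul (y k) (y k))) = sqn t (y k) by rewrite /sqn ys.
have := le_trans (Re_dist _ _) (wu (y k)); rewrite tr_s.
have := le_trans (Re_dist _ _) (deriv k w); rewrite {1}/t cReD.
have := y_bound k; have := nrm_s (y k); have := nrm_ge0 t (y k); have := nrm_ge0 s (y k).
have : nrm t w <= 2.
  apply: nrm_le => //; rewrite sqn_t.
  have := sqn_le lin_s bd_s w; have := sqn_le lin_s' bd_s' w; rewrite s1 s1' !mul1r.
  have : rnorm w ^+ 2 <= 1 by rewrite expr_le1 ?rnorm_ge0.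
  lra.
have := nrm_ge0 t w; have := d_gt0 k; have := Re_le_cabs (s' (cmul w (y k))).
have : h ^+ 2 <= h by rewrite expr2 ler_piMr// ltW.
rewrite /gap !ler_norml => hh Rs d0 w0 w2 n0 n1 n2 n3 /andP[_ a1] /andP[a2 _] /andP[a3 _].
have b1 : d k * nrm t w <= h * 2 by rewrite ler_pM// ltW.
have b2 : h * nrm s (y k) <= h * 3 by rewrite ler_wpM2l ?(ltW h0)//; lra.
have b3 : d k * nrm t (y k) <= h * 3 by rewrite ler_pM// ltW.
lra.
Qed.

End Disjoint.

(** * Products, joins, truncation and interpolation *)

Section NearUnitOps.
Variables (R : realType) (A : cstarAlgType R) (f : A -> R[i]).
Hypothesis trf : is_trace f.
Implicit Types (w x y z : A) (d e : R).

Let fs : scalar f. Proof. by case: trf. Qed.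
Let fb : bounded_functional f. Proof. by case: trf. Qed.
Let fp : positive_functional f. Proof. by case: trf. Qed.
Let ft a b : f (cmul a b) = f (cmul b a). Proof. by case: trf. Qed.

Lemma near_unitM y w d e : rnorm y <= 1 -> 0 <= e ->
  near_unit f y d -> near_unit f w e -> near_unit f (cmul y w) (d + e).
Proof.
move=> y1 e0 yd we z.
have -> : f z - f (cmul z (cmul y w)) =
    (f z - f (cmul z y)) + (f (cmul z y) - f (cmul (cmul z y) w)).
  by rewrite cmulA; ring.
apply: le_trans (cabsD _ _) _; rewrite mulrDl; apply: lerD => //.
apply: le_trans (we _) _; rewrite ler_wpM2l//.
by apply: le_trans (nrmMr_le trf _ _) _; rewrite ler_piMr ?nrm_ge0.
Qed.

(** The join y + w - y w is 1 - (1 - y)(1 - w), so it is close to 1 as soon as one of y, w is; the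
    error is multiplied by a bound for the other factor. *)
Lemma near_unit_joinl y w d : 0 <= d -> near_unit f y d ->
  near_unit f (y + w - cmul y w) ((1 + rnorm w) * d).
Proof.
move=> d0 yd z.
have -> : f z - f (cmul z (y + w - cmul y w)) =
    f (z - cmul w z) - f (cmul (z - cmul w z) y).
  rewrite cmulBl !cmulBr cmulDr !functionalB// functionalD// cmulA [f (cmul z w)]ft.
  by rewrite [f (cmul (cmul z y) w)]ft cmulA; ring.
apply: le_trans (yd _) _; rewrite [X in _ <= X * _]mulrC -mulrA ler_wpM2l//.
apply: le_trans (nrmB fs fp _ _) _; rewrite mulrDl mul1r lerD2l; exact: nrmM_le.
Qed.

Lemma near_unit_joinr y w d : 0 <= d -> near_unit f w d ->
  near_unit f (y + w - cmul y w) ((1 + rnorm y) * d).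
Proof.
move=> d0 wd z.
have -> : f z - f (cmul z (y + w - cmul y w)) =
    f (z - cmul z y) - f (cmul (z - cmul z y) w).
  by rewrite cmulBl !cmulBr cmulDr !functionalB// functionalD// cmulA; ring.
apply: le_trans (wd _) _; rewrite [X in _ <= X * _]mulrC -mulrA ler_wpM2l//.
apply: le_trans (nrmB fs fp _ _) _; rewrite mulrDl mul1r lerD2l [leRHS]mulrC.
exact: nrmMr_le.
Qed.

Lemma nrm_join y w : nrm f (y + w - cmul y w) <= nrm f y + (1 + rnorm y) * nrm f w.
Proof.
have := nrmB fs fp (y + w) (cmul y w); have := nrmD fs fp y w.
have := nrmM_le fs fp fb y w; lra.
Qed.

Lemma near_unit_sym y d : near_unit f y d ->
  near_unit f ((2^-1)%:C *: (y + cstar y)) d.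
Proof.
move=> yd z; have := yd z; have := yd (cstar z); rewrite nrm_star//.
have -> : f (cstar z) - f (cmul (cstar z) y) = conjc (f z - f (cmul z (cstar y))).
  by rewrite rmorphB/= -!functional_star// cstarM cstarK [f (cmul y _)]ft.
rewrite cabs_conj => h1 h2.
have -> : f z - f (cmul z ((2^-1)%:C *: (y + cstar y))) =
    (2^-1)%:C * ((f z - f (cmul z y)) + (f z - f (cmul z (cstar y)))).
  rewrite -cscaleAr functionalZ// cmulDr functionalD//.
  have -> : (2^-1)%:C = 2^-1 :> R[i] by rewrite fmorphV rmorph_nat.
  by field.
rewrite cabsM cabsR ger0_norm ?invr_ge0//.
have := cabsD (f z - f (cmul z y)) (f z - f (cmul z (cstar y))); lra.
Qed.

Lemma nrm_sym y : nrm f ((2^-1)%:C *: (y + cstar y)) <= nrm f y.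
Proof.
rewrite nrmZ// cabsR ger0_norm ?invr_ge0//.
have := nrmD fs fp y (cstar y); rewrite nrm_star//; lra.
Qed.

(** A contraction w with f(w) close to 1 stands in for the unit: f(y), f(y w) = f(w y), f(w) and 1
    are successively within d. *)
Lemma state_near_unit y d : functional_norm f = 1 -> 0 < d -> rnorm y <= 1 ->
  near_unit f y d -> cabs (f y - 1) <= 3 * d.
Proof.
move=> f1 d0 y1 yd.
have [|w w1] := functional_norm_approx_Re (d := d ^+ 2 / 2) fs fb.
  by rewrite divr_gt0// exprn_gt0.
rewrite f1 => fw; have wd := near_unit_contraction trf f1 (ltW d0) w1 fw.
have nrm1 x : rnorm x <= 1 -> nrm f x <= 1.
  move=> x1; apply: nrm_le => //; have := sqn_le fs fb x; rewrite f1 mul1r => xx.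
  by apply: le_trans xx _; rewrite expr1n expr_le1 ?rnorm_ge0.
have dist1 : cabs (f w - 1) <= d.
  rewrite -ler_sqr ?nnegrE ?cabs_ge0 ?(ltW d0)//.
  have : cabs (f w) <= 1 by rewrite -f1; exact: functional_norm_ub1.
  have := cabs_ge0 (f w); have := cabsq (f w); have := cabsq (f w - 1).
  move: fw; case: (f w) => u v /=; rewrite subr0.
  set p := cabs _; set q := cabs _; nra.
have -> : f y - 1 = (f y - f (cmul y w)) - (f w - f (cmul w y)) + (f w - 1).
  by rewrite [f (cmul w y)]ft; ring.
apply: le_trans (cabsD _ _) _.
have := cabsD (f y - f (cmul y w)) (- (f w - f (cmul w y))); rewrite cabsN.
have := wd y; have := yd w; have := nrm1 _ y1; have := nrm1 _ w1; nra.
Qed.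

End NearUnitOps.

Lemma near_unit_le (R : realType) (A : cstarAlgType R) (f : A -> R[i]) (x : A) (d e : R) :
  d <= e -> near_unit f x d -> near_unit f x e.
Proof. by move=> de xd z; apply: le_trans (xd z) _; rewrite ler_wpM2r ?nrm_ge0. Qed.

Section Truncation.
Variables (R : realType) (A : cstarAlgType R).
Implicit Types (e x y : A) (f : A -> R[i]) (d : R).

(* For self-adjoint [y] take [e = 2 y (1 + y^2)^-1]; then
   [1 - e = (1 - y)^2 (1 + y^2)^-1]. *)
Let truncate_sa y : cstar y = y -> exists2 e, rnorm e <= 1 &
  forall f, is_trace f -> (forall d, 0 <= d -> near_unit f y d -> near_unit f e (3 * d))
    /\ nrm f e <= 4 * nrm f y.
Proof.
move=> ys; have [g yg] := quasi_exists ys; have [gs yg_comm yyg] := yg.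
pose v := y - cmul y g.
have v1 : rnorm v <= 2^-1 := quasi_rnorm_imag ys yg.
have g1 : rnorm g <= 1 := quasi_rnorm ys yg.
exists (2 *: v); first by rewrite rnormZn; lra.
move=> f trf; have [fs fb fp ft] := trf; split=> [d d0 yd|]; last first.
  rewrite -[2](rmorph_nat (real_complex R)) nrmZ// cabsR ger0_norm//.
  have := nrmB fs fp y (cmul y g); have := nrmMr_le trf g y.
  have := nrm_ge0 f y; rewrite -/v; nra.
have vy : cmul v y = g by rewrite cmulBl -cmulA -yg_comm cmulA -{1}yyg addrK.
(* In the unitization 1 - 2 v = (1 - g - v)(1 - y). As g + v has norm at most 3/2, the join lemma
   gives the factor 5/2. *)
have eE : (g + v) + y - cmul (g + v) y = 2 *: v.
  rewrite cmulDl vy -yg_comm [_ + g]addrC opprD addrA -[g + v + y]addrA addrAC.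
  rewrite addrAC [g + _]addrC addrK -addrA.
  by rewrite -/v scaler_nat mulr2n.
rewrite -eE; apply: near_unit_le (near_unit_joinr trf (g + v) d0 yd).
by rewrite ler_wpM2r//; have := rnormD g v; lra.
Qed.

Lemma truncate x : exists2 e, rnorm e <= 1 &
  forall f, is_trace f -> (forall d, 0 <= d -> near_unit f x d -> near_unit f e (3 * d))
    /\ nrm f e <= 4 * nrm f x.
Proof.
have [|e e1 eP] := @truncate_sa ((2^-1)%:C *: (x + cstar x)).
  by rewrite cstarZc conjc_real cstarD cstarK addrC.
exists e => // f trf; have [near small] := eP f trf; split=> [d d0 xd|].
  by apply: near => //; exact: near_unit_sym.
by have := nrm_sym trf x; lra.
Qed.

End Truncation.

Section Separation.
Variables (R : realType) (A : cstarAlgType R) (U : ultra_on nat).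
Hypothesis U_np : nonprincipal U.
Variable s : nat -> A -> R[i].
Hypotheses (s_ext : forall j, extremal_tracial_state (s j)) (s_inj : injective s).
Implicit Types (d : R) (n m i j : nat) (P : pred nat).

Let trs j : is_trace (s j). Proof. by case: (s_ext j) => -[]. Qed.
Let s1 j : functional_norm (s j) = 1. Proof. by case: (s_ext j) => -[]. Qed.
Let lin j : scalar (s j). Proof. by case: (trs j). Qed.
Let bd j : bounded_functional (s j). Proof. by case: (trs j). Qed.
Let pos j : positive_functional (s j). Proof. by case: (trs j). Qed.

Let sep2 i j d : i != j -> 0 < d ->
  exists e, [/\ rnorm e <= 1, near_unit (s i) e d & nrm (s j) e <= d].
Proof.
(* Dividing by 4 absorbs the factors 3 and 4 lost in [truncate]. *)
move=> ij d0; have d4 : 0 < d / 4 by rewrite divr_gt0.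
have sij : s i <> s j by move=> /s_inj /eqP; apply/negP.
have [|y ys] := extremal_disjoint U_np (s_ext i) (s_ext j) sij (e := (d / 4) ^+ 2).
  by rewrite exprn_gt0.
move=> gap; have [e e1 eP] := truncate y; exists e; split=> //.
  have [near _] := eP _ (trs i).
  apply: near_unit_le (near _ (ltW d4) _); first lra.
  apply: near_unit_gap => //; first exact: ltW.
  by have := sqn_ge0 (pos j) y; lra.
have [_ small] := eP _ (trs j); apply: le_trans small _.
suff : nrm (s j) y <= d / 4 by lra.
apply: nrm_le => //; first exact: ltW.
by have := state_gap_ge (trs i) (s1 i) (lexx (sqn (s i) y)); lra.
Qed.

(** The elements separating i from each single j are multiplied together: a product of contractions
    is small for s j once one factor is, and the distances to 1 for s i add up. *)
Let sep1 i n d : 0 < d -> exists e, [/\ rnorm e <= 1, near_unit (s i) e d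
  & forall j, (j < n)%N -> j != i -> nrm (s j) e <= d].
Proof.
elim: n d => [|n IH] d d0.
  have [|w w1] := functional_norm_approx_Re (d := d ^+ 2 / 2) (lin i) (bd i).
    by rewrite divr_gt0// exprn_gt0.
  rewrite s1 => fw; exists w; split=> //.
  by apply: near_unit_contraction; rewrite ?(ltW d0).
have d2 : 0 < d / 2 by rewrite divr_gt0.
have [e [e1 ei ej]] := IH _ d2.
have [ni|ni] := eqVneq n i.
  exists e; split=> // [|j]; first by apply: near_unit_le ei; lra.
  rewrite ltnS leq_eqVlt => /orP[/eqP ->|jn ji]; first by rewrite ni eqxx.
  by have := ej j jn ji; lra.
have [|w [w1 wi wn]] := @sep2 i n _ _ d2; first by rewrite eq_sym.
exists (cmul e w); split.
- by apply: le_trans (rnormM _ _) _; have := rnorm_ge0 e; have := rnorm_ge0 w; nra.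
- by rewrite [d]splitr; apply: near_unitM => //; exact: ltW.
move=> j; rewrite ltnS leq_eqVlt => /orP[/eqP ->|jn] ji.
  apply: le_trans (nrmM_le (lin n) (pos n) (bd n) _ _) _.
  have := nrm_ge0 (s n) w; have := rnorm_ge0 e; nra.
apply: le_trans (nrmMr_le (trs j) _ _) _.
have := ej j jn ji; have := nrm_ge0 (s j) e; have := rnorm_ge0 w; nra.
Qed.

(** The indices m satisfying P are added one at a time by a join with an approximate indicator of m.
    Each join is truncated to return to the unit ball. *)
Let sepP P n m d : 0 < d -> exists2 e, rnorm e <= 1 & forall j, (j < n)%N ->
  if P j && (j < m)%N then near_unit (s j) e d else nrm (s j) e <= d.
Proof.
elim: m d => [|m IH] d d0.
  exists 0; first by rewrite rnorm0.
  move=> j _; rewrite ltn0 andbF /nrm /sqn cmulr0 functional0// sqrtr0.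
  exact: ltW.
(* A join followed by truncation multiplies errors by at most 3 * 2 near 1 and by 4 * (1 + 2) near
   0. *)
have d12 : 0 < d / 12 by rewrite divr_gt0.
have [y y1 yj] := IH _ d12.
have [Pm|Pm] := boolP (P m); last first.
  exists y => // j jn; have := yj j jn.
  have [->|jm] := eqVneq j m; first by rewrite (negPf Pm)/=; lra.
  have -> : (j < m.+1)%N = (j < m)%N by rewrite ltnS leq_eqVlt (negPf jm).
  by case: ifP => _ h; [apply: near_unit_le h; lra | lra].
have [w [w1 wm wj]] := @sep1 m n _ d12.
have [e e1 eP] := truncate (y + w - cmul y w); exists e => // j jn.
have [near small] := eP _ (trs j); have := yj j jn.
have y0 := rnorm_ge0 y; have w0 := rnorm_ge0 w.
have [->|jm] := eqVneq j m.
  rewrite Pm ltnn ltnSn => _.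
  have [{}near _] := eP _ (trs m).
  have b0 : 0 <= (1 + rnorm y) * (d / 12) by rewrite mulr_ge0 ?(ltW d12)//; lra.
  apply: near_unit_le (near _ b0 _); first by nra.
  by apply: near_unit_joinr => //; exact: ltW.
have -> : (j < m.+1)%N = (j < m)%N by rewrite ltnS leq_eqVlt (negPf jm).
case: ifP => _ h.
  have b0 : 0 <= (1 + rnorm w) * (d / 12) by rewrite mulr_ge0 ?(ltW d12)//; lra.
  apply: near_unit_le (near _ b0 _); first by nra.
  by apply: near_unit_joinl => //; exact: ltW.
apply: le_trans small _; have := nrm_join (trs j) y w; have := wj j jn jm.
have := nrm_ge0 (s j) w; nra.
Qed.

Lemma extremal_interpolation P n d : 0 < d -> exists2 a : A, rnorm a <= 1 &
  forall j, (j < n)%N -> cabs (s j a - (P j)%:R) <= d.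
Proof.
move=> d0; have d3 : 0 < d / 3 by rewrite divr_gt0.
have [e e1 eP] := sepP P n n d3; exists e => // j jn; have := eP j jn.
rewrite jn andbT; case: (P j) => h.
  by apply: le_trans (state_near_unit (trs j) (s1 j) d3 e1 h) _; lra.
rewrite subr0; apply: le_trans (functional_CS (lin j) (pos j) (bd j) e) _.
by rewrite s1 sqrtr1 mul1r; lra.
Qed.

End Separation.

(** * Ultrafilters and traces on the ultrapower *)

Lemma mem_leq_sumn (F : seq nat) i : i \in F -> (i <= sumn F)%N.
Proof.
elim: F => //= j F IH; rewrite inE => /orP[/eqP ->|/IH iF]; first exact: leq_addr.
exact: leq_trans iF (leq_addl _ _).
Qed.

Section IndependentFamily.
Implicit Types (X Y : set nat) (S : set (set nat)) (F : seq nat) (G : seq (seq nat)).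

Let trace_on X F := [seq i <- F | `[< X i >]].

(* Hausdorff's independent family, on codes of pairs of a finite set and a
   finite family of finite sets. *)
Definition indep X : set nat :=
  [set k | exists F G, unpickle k = Some (F, G) /\ trace_on X F \in G].

(** Each k lies in finitely many of these sets, so an ultrafilter containing all of them is
    nonprincipal. *)
Let contains i : set nat :=
  [set k | exists F G, unpickle k = Some (F, G) /\ i \in F].

Let cylinder F (Xs Ys : seq (set nat)) : set nat :=
  [set k | [/\ {in F, forall i, contains i k}, {in Xs, forall X, indep X k}
            & {in Ys, forall Y, ~ indep Y k}]].

Let cylinder_filter S : set_system nat := [set B | exists F (Xs Ys : seq (set nat)),
  [/\ {in Xs, forall X, S X}, {in Ys, forall Y, ~ S Y} & cylinder F Xs Ys `<=` B]].

(** Enlarge F to F' by a point separating each X in Xs from each Y in Ys. On F' no Y has the same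
    trace as an X, so the code of F' with the list of traces of Xs belongs to the cylinder. *)
Let cylinder_neq0 S F (Xs Ys : seq (set nat)) :
  {in Xs, forall X, S X} -> {in Ys, forall Y, ~ S Y} -> cylinder F Xs Ys !=set0.
Proof.
move=> XS YS.
have sep X Y : {i : nat | S X -> ~ S Y -> `[< X i >] != `[< Y i >]}.
  apply: cid; have [[SX SY]|nXY] := pselect (S X /\ ~ S Y); last first.
    by exists 0%N => SX SY; case: nXY.
  have [i XY] : exists i, ~ (X i <-> Y i).
    apply: contrapT => /forallNP XY; apply: SY; suff <- : X = Y by [].
    by apply/funext => i; apply/propext; apply: contrapT; exact: XY.
  exists i => _ _; apply/eqP => XYi; apply: XY.
  by split=> Hi; apply/asboolP; [rewrite -XYi | rewrite XYi]; apply/asboolP.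
pose F' := F ++ [seq sval (sep X Y) | X <- Xs, Y <- Ys].
pose G := [seq trace_on X F' | X <- Xs].
exists (pickle (F', G)); split.
- by move=> i iF; exists F', G; rewrite pickleK mem_cat iF.
- by move=> X XX; exists F', G; rewrite pickleK; split=> //; apply: map_f.
move=> Y YY [F1 [G1 []]]; rewrite pickleK => -[<- <-] /mapP[X XX XYF].
have iF : sval (sep X Y) \in F'.
  by rewrite mem_cat; apply/orP; right; apply/allpairsP; exists (X, Y).
have /eqP[] := svalP (sep X Y) (XS _ XX) (YS _ YY).
have := congr1 (fun L => sval (sep X Y) \in L) XYF.
by rewrite /trace_on !mem_filter iF !andbT.
Qed.

Let cylinder_proper S : ProperFilter (cylinder_filter S).
Proof.
split.
  move=> [F [Xs [Ys [XS YS FXY]]]]; have [k kF] := cylinder_neq0 F XS YS.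
  exact: FXY kF.
split.
- by exists [::], [::], [::].
- move=> B1 B2 [F1 [X1 [Y1 [XS1 YS1 B1E]]]] [F2 [X2 [Y2 [XS2 YS2 B2E]]]].
  exists (F1 ++ F2), (X1 ++ X2), (Y1 ++ Y2); split.
  + by move=> X; rewrite mem_cat => /orP[/XS1|/XS2].
  + by move=> Y; rewrite mem_cat => /orP[/YS1|/YS2].
  move=> k [kF kX kY]; split.
    apply: B1E; split=> [i iF|X XX|Y YY].
    * by apply: kF; rewrite mem_cat iF.
    * by apply: kX; rewrite mem_cat XX.
    * by apply: kY; rewrite mem_cat YY.
  apply: B2E; split=> [i iF|X XX|Y YY].
  * by apply: kF; rewrite mem_cat iF orbT.
  * by apply: kX; rewrite mem_cat XX orbT.
  * by apply: kY; rewrite mem_cat YY orbT.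
- move=> B1 B2 B12 [F [Xs [Ys [XS YS BE]]]]; exists F, Xs, Ys; split=> //.
  exact: subset_trans BE B12.
Qed.

Lemma independent_ultrafilter S : exists V : ultra_on nat,
  [/\ nonprincipal V, forall X, S X -> ultra_system V (indep X)
    & forall X, ~ S X -> ultra_system V (~` indep X)].
Proof.
have [V [VU FV]] := ultraFilterLemma (cylinder_proper S).
exists (UltraOn VU); split=> /=.
- move=> k Vk.
  have kc i : contains i k.
    apply/principal_filterP; rewrite -Vk /=; apply: FV.
    by exists [:: i], [::], [::]; split=> // l [/(_ i) + _ _]; apply; rewrite inE.
  have [F [G [kE _]]] := kc 0%N.
  (* One more than the sum of F exceeds every element of F. *)
  have [F1 [G1 []]] := kc (sumn F).+1; rewrite kE => -[<- _] /mem_leq_sumn.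
  by rewrite ltnn.
- move=> X SX; apply: FV; exists [::], [:: X], [::]; split=> //.
    by move=> Y; rewrite inE => /eqP ->.
  by move=> k [_ /(_ X) + _]; apply; rewrite inE.
- move=> X SX; apply: FV; exists [::], [::], [:: X]; split=> //.
    by move=> Y; rewrite inE => /eqP ->.
  by move=> k [_ _ /(_ X)]; apply; rewrite inE.
Qed.

End IndependentFamily.

Lemma ulim_trace (R : realType) (B : cstarAlgType R) (V : ultra_on nat)
    (f : nat -> B -> R[i]) :
  (forall k, is_trace (f k)) -> (forall k b, cabs (f k b) <= rnorm b) ->
  is_trace (fun b => ulim (ultra_system V) (f^~ b)).
Proof.
move=> trf fb.
have fc b : uconv (ultra_system V) (f^~ b) (ulim (ultra_system V) (f^~ b)).
  by apply: ulimP => k; exact: fb.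
split.
- move=> c a b; apply: ulim_eq.
  apply: uconv_eq (uconvD (uconvZ c (fc a)) (fc b)) => k /=.
  by have [fs _ _ _] := trf k; rewrite functionalD// functionalZ.
- apply/functional_boundedP; exists 1 => b; rewrite mul1r.
  by apply: uconv_cabs_le (fc b) _ => k; exact: fb.
- by move=> b; apply: (uconv_ge0 (fc _)) => k; case: (trf k).
- by move=> a b; congr ulim; apply/funext => k; case: (trf k).
Qed.

Section UltrapowerTrace.
Variables (R : realType) (U : ultra_on nat) (A : cstarAlgType R) (s : A -> R[i]).
Hypotheses (trs : is_trace s) (s1 : functional_norm s = 1).
Implicit Types (a b : linfty A) (x y : ultrapower U A).

Let sl : scalar s. Proof. by case: trs. Qed.

Let sb z : cabs (s z) <= rnorm z.
Proof. by rewrite -[leRHS]mul1r -s1; apply: functional_norm_ub => //; case: trs. Qed.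

(** Independence of the representative is [ultra_trace_conv]. *)
Definition ultra_trace x : R[i] := ulim (ultra_system U) (fun n => s (repr x n)).

Lemma ultra_trace_conv a :
  uconv (ultra_system U) (fun n => s (a n)) (ultra_trace (ultra_class U a)).
Proof.
set r := repr (ultra_class U a).
have rb n : cabs (s (r n)) <= rnorm r.
  by apply: le_trans (sb _) _; exact: linfty_norm_ge.
have ar : uconv (ultra_system U) (fun n => s (a n - r n)) 0.
  apply: (uconv_near (y := fun n => rnorm ((r - a) n))).
    exact: ((null_seqP U _).1 (ultra_repr U a)).
  by apply: filterE => n /=; rewrite subr0 (rdistC (r n)).
rewrite -[ultra_trace _]add0r; apply: uconv_eq (uconvD ar (ulimP rb)) => n.
by rewrite -functionalD// subrK.
Qed.

Lemma ultra_trace_le x : cabs (ultra_trace x) <= rnorm x.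
Proof.
apply/ler_addgt0Pr => e e0.
have [|a ax ae] := @ultra_norm_lift R U A x (rnorm x + e); first by rewrite ltrDl.
apply: le_trans (ltW ae); rewrite -ax.
apply: uconv_cabs_le (ultra_trace_conv a) _ => n.
by apply: le_trans (sb _) _; exact: linfty_norm_ge.
Qed.

Lemma ultra_trace_trace : is_trace ultra_trace.
Proof.
have tc := ultra_trace_conv.
have E x : exists a, x = ultra_class U a by exists (repr x); rewrite ultra_classK.
split.
- move=> c x y; have [a ->] := E x; have [b ->] := E y.
  rewrite -ultra_classZ -ultra_classD; apply: uconv_unique (tc _) _.
  apply: uconv_eq (uconvD (uconvZ c (tc a)) (tc b)) => n /=.
  by rewrite functionalD// functionalZ.
- by apply/functional_boundedP; exists 1 => x; rewrite mul1r ultra_trace_le.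
- move=> x; have [a ->] := E x.
  have -> : cmul (cstar (ultra_class U a)) (ultra_class U a) =
      ultra_class U (cmul (cstar a) a).
    by rewrite -ultra_mulE -ultra_starE.
  by apply: (uconv_ge0 (tc _)) => n /=; case: trs.
- move=> x y; have [a ->] := E x; have [b ->] := E y.
  have M u v : cmul (ultra_class U u) (ultra_class U v) = ultra_class U (cmul u v).
    exact: ultra_mulE.
  rewrite !M; apply: uconv_unique (tc _) _.
  by apply: uconv_eq (tc _) => n /=; case: trs.
Qed.

End UltrapowerTrace.

Lemma ultralimit_uconv (R : realType) (U : ultra_on nat) (A : cstarAlgType R)
    (rho : nat -> A -> R[i]) (phi : ultrapower U A -> R[i]) (a : linfty A) :
  is_ultralimit rho phi ->
  uconv (ultra_system U) (fun n => rho n (a n)) (phi (ultra_class U a)).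
Proof.
move=> /(_ a)/cvg_ballP aU e e0; have eC : 0 < e%:C :> R[i] by rewrite ltcR.
apply: filterS (aU _ eC) => n.
by rewrite -ball_normE /ball_/= distrC cabsE ltcR.
Qed.

Theorem corollary1p5 (R : realType) (U : ultra_on nat) (A : cstarAlgType R)
    (U_nonprincipal : nonprincipal U)
    (A_extremal : infinite_set [set tau : A -> R[i] | extremal_tracial_state tau]) :
  exists tau : set (set nat) -> (ultrapower U A -> R[i]),
    injective tau /\
    forall S : set (set nat), is_trace (tau S) /\ ~ is_ultralimit_of_traces (tau S).
Proof.
have [s [s_ext s_inj]] : exists s : nat -> A -> R[i],
    (forall j, extremal_tracial_state (s j)) /\ injective s.
  have /infiniteP/card_leP[f] := A_extremal.
  exists (fun j => val (f (SigSub (mem_setT j)))); split=> [j|i j /val_inj fij].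
    exact: set_mem (valP (f _)).
  by have [] := inj (in_setT _) (in_setT _) fij.
have trs j : is_trace (s j) by case: (s_ext j) => -[].
have s1 j : functional_norm (s j) = 1 by case: (s_ext j) => -[].
(* Stage n controls the indices below n up to 1 / (n + 1), so along U every index is eventually
   controlled with vanishing error. *)
have interp (P : pred nat) n : {a : A | rnorm a <= 1
    & forall j, (j < n)%N -> cabs (s j a - (P j)%:R) <= n.+1%:R^-1}.
  by apply/cid2; apply: (extremal_interpolation U_nonprincipal s_ext s_inj); rewrite invr_gt0.
have ab (P : nat -> pred nat) : (fun n => s2val (interp (P n) n)) \in @bounded_seq R A.
  by apply/asboolP; exists 1 => n; exact: (s2valP (interp (P n) n)).
(* The predicate may vary with the stage, as the diagonal sequence below requires. *)
pose c P := ultra_class U (Linfty (ab P)).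
pose sU k := ultra_trace (U := U) (s k).
have sUc P k (b : bool) : ultra_system U [set n | P n k = b] -> sU k (c P) = b%:R.
  move=> Pk; apply: (uconv_unique (ultra_trace_conv U (trs k) (s1 k) (Linfty (ab P)))).
  apply: (uconv_near (y := fun n => n.+1%:R^-1)).
    by move=> e; exact: nonprincipal_inv.
  apply: filterS2 Pk (nonprincipal_ge U_nonprincipal k.+1) => n /= <- kn.
  exact: (s2valP' (interp (P n) n)).
pose V S := sval (cid (independent_ultrafilter S)).
pose tau S x := ulim (ultra_system (V S)) (fun k => sU k x).
have tau_val S x (b : bool) :
    ultra_system (V S) [set k | sU k x = b%:R] -> tau S x = b%:R.
  move=> Sb; apply: ulim_eq => e e0; apply: filterS Sb => k /= ->.
  by rewrite subrr cabs0.
exists tau; split=> [S S' SS'|S].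
  apply/funext => X.
  (* Evaluating at the element attached to [indep X] tells whether X belongs to S0, which gives
     injectivity. *)
  have val S0 : tau S0 (c (fun=> fun k => `[< indep X k >])) = `[< S0 X >]%:R.
    apply: tau_val; have [_ VX VNX] := svalP (cid (independent_ultrafilter S0)).
    have [SX|SX] := pselect (S0 X).
      apply: filterS (VX _ SX) => k /= kX; apply: sUc; apply: filterE => n /=.
      by rewrite !asboolT.
    apply: filterS (VNX _ SX) => k /= kX; apply: sUc; apply: filterE => n /=.
    by rewrite !asboolF.
  have := val S; rewrite SS' val => /eqP; rewrite eqr_nat => /eqP SE.
  by apply/propext; split=> /asboolP XS; apply/asboolP; move: SE XS; do 2!case: `[< _ >].
split.
  apply: ulim_trace => k; first exact: ultra_trace_trace.
  by move=> x; exact: ultra_trace_le.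
move=> [rho [_ _ rhoU]].
have [V_np _ _] := svalP (cid (independent_ultrafilter S)).
pose seg k : nat -> pred nat := fun _ j => (j < k)%N.
pose small n k := cabs (rho n (s2val (interp (seg k n) n))) < 2^-1.
have smallU k : ultra_system U [set n | small n k].
  (* The trace s_j^U vanishes on this element for all j >= k, and V S contains that tail. *)
  have tau0 : tau S (c (seg k)) = false%:R.
    apply: tau_val; apply: filterS (nonprincipal_ge V_np k) => j /= kj.
    apply: (sUc (seg k) j false); apply: filterE => n /=.
    by rewrite /seg ltnNge kj.
  have h0 : 0 < 2^-1 :> R by rewrite invr_gt0.
  have := ultralimit_uconv (Linfty (ab (seg k))) rhoU h0; rewrite -/(c _) tau0.
  by apply: filterS => n /=; rewrite subr0.
(* An empty maximum is 0, hence the assumption [small n 0] in [gS]; it holds for U-almost all n. *)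
pose g n := \max_(k < n.+1 | small n k) (k : nat).
have gS n : small n 0%N -> small n (g n).
  by move=> n0; rewrite /g (@bigop.bigmax_eq_arg _ ord0)//; case: arg_maxnP.
have gge k : ultra_system U [set n | (k <= g n)%N].
  apply: filterS2 (smallU k) (nonprincipal_ge U_nonprincipal k) => n /= nk kn.
  have kn1 : (k < n.+1)%N by [].
  exact: (@bigop.leq_bigmax_cond _ _ _ (Ordinal kn1)).
(* The diagonal: at stage n this is [seg (g n) n], where rho n is small, but g tends to infinity
   along U, so every s_j^U is 1 on the resulting element. *)
pose P n : pred nat := fun j => (j < g n)%N.
have tau1 : tau S (c P) = true%:R.
  apply: tau_val; apply: filterE => j /=; apply: (sUc P j true).
  by apply: filterS (gge j.+1).
have h0 : 0 < 2^-1 :> R by rewrite invr_gt0.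
have := ultralimit_uconv (Linfty (ab P)) rhoU h0; rewrite -/(c _) tau1 => U1.
have [n /= [n1 n0]] := filter_ex (filterI U1 (smallU 0%N)).
have := gS n n0; rewrite /small.
have -> : seg (g n) n = P n by [].
(* At such an n, 1 is at most the modulus of the value of rho n plus its distance to 1, both less
   than 1/2. *)
move=> n2; have := cabsD (rho n (s2val (interp (P n) n)))
  (- (rho n (s2val (interp (P n) n)) - 1)).
rewrite cabsN opprB addrC subrK -[1]/(1%:C) cabsR normr1.
move: n1 n2; rewrite /=; lra.
Qed.
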